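(* Let $I=[0,1]$, let $f_{1,\infty}=\{f_n\}_{n\ge 1}$ be a sequence of surjective continuous maps $f_n:I\to I$, and suppose that $f_{1,\infty}$ converges uniformly to a map $f:I\to I$. If $f$ is Li-Yorke chaotic (LYC), then the nonautonomous system $(I,f_{1,\infty})$ is also LYC.
   Context: The nonautonomous system $(I,f_{1,\infty})$ is given by the sequence $f_{1,\infty}=\{f_n\}_{n\ge1}$; the trajectory of $x\in I$ is $\{x_n\}_{n\ge0}$ with $x_0=x$ and $x_n=(f_n\circ f_{n-1}\circ\cdots\circ f_1)(x)$. A single map $f$ is viewed as the constant sequence $f_n=f$. (The limit map $f$ is also taken to be surjective, which is automatic for a uniform limit of surjective continuous maps of $I$.) For $\varepsilon>0$, a pair $(x,y)$ of points with trajectories $\{x_n\}$, $\{y_n\}$ is an $\varepsilon$-Li-Yorke pair if $\limsup_{n\to\infty}|x_n-y_n|\ge\varepsilon$ and $\liminf_{n\to\infty}|x_n-y_n|=0$. The system is Li-Yorke chaotic (LYC) if there are an $\varepsilon>0$ and an uncountable set $S\subseteq I$ such that every two distinct points $x,y\in S$ form an $\varepsilon$-Li-Yorke pair. *)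

(* Defs.v *)
From mathcomp Require Import all_boot all_order all_algebra.
From mathcomp Require Import all_classical all_reals all_analysis.
Import Order.TTheory GRing.Theory Num.Theory numFieldNormedType.Exports.

Set Implicit Arguments.
Unset Strict Implicit.
Unset Printing Implicit Defensive.

Local Open Scope classical_set_scope.
Local Open Scope ring_scope.

(* A self-map of I is represented by a function R -> R sending I to I; its
   values outside I are irrelevant. *)
Definition I01 {R : realType} : set R := `[0, 1].

(* The sequence f_1, f_2, ... is indexed from 1; the value fs 0 is never used. *)
Fixpoint trajectory (R : realType) (fs : nat -> R -> R) (x : R) (n : nat) : R :=
  if n is m.+1 then fs m.+1 (trajectory fs x m) else x.

(* Upper and lower limits are taken in the extended reals, where they always
   exist. *)
Definition Li_Yorke_pair (R : realType) (fs : nat -> R -> R) (eps x y : R) :=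
  let dist := fun n => (`|trajectory fs x n - trajectory fs y n|)%:E in
  (eps%:E <= limn_esup dist)%E /\ limn_einf dist = 0%E.

Definition LYC (R : realType) (fs : nat -> R -> R) : Prop :=
  exists eps : R, 0 < eps /\
  exists S : set R, [/\ S `<=` I01, ~ countable S &
    forall x y : R, S x -> S y -> x <> y -> Li_Yorke_pair fs eps x y].

(* Main.v *)
Require Import Defs.
From mathcomp Require Import all_boot all_order all_algebra.
From mathcomp Require Import all_classical all_reals all_analysis.
From mathcomp Require Import lra zify.
Import Order.TTheory GRing.Theory Num.Theory numFieldNormedType.Exports.

Set Implicit Arguments.
Unset Strict Implicit.
Unset Printing Implicit Defensive.

Local Open Scope classical_set_scope.
Local Open Scope ring_scope.

(** Errors accumulate along a nonautonomous orbit, so that orbits of [f] cannot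
    be followed for ever. What survives a perturbation is a strict covering:
    if [f^m] maps the interval [K] across [L], beyond both endpoints of [L], then
    so does the composition of [m] consecutive maps of the system, late enough
    ([covers_onto]). How late depends on the covering, and an infinite chain of
    coverings admits no uniform bound; but a chain can wait at an interval
    that strictly covers itself. This leads to the notion of a [scrambling]
    family of intervals: from each of its members, after looping there for as
    long as needed, a point can be sent at will to one of two distant intervals,
    and both of these are sent, at one common time, across a same short interval
    and back to the family. Nested compactness turns such chains into points
    indexed by binary sequences ([scrambled_family]), and the surjectivity of
    the maps pulls these points back to time 0 ([LYC_of_scrambling]). It remains
    to find a scrambling family for [f].

    If some iterate [f^(2^k)] has a horseshoe, the horseshoe itself is such a
    family ([horseshoe_scrambling]).

    Otherwise, take two points [x], [y] of the scrambled set of [f] whose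
    orbits do not converge along any progression modulo a power of 2; at most
    one point of the scrambled set is excluded ([li_yorke_nonconvergent]).
    Without horseshoes, such an orbit eventually alternates between the two
    sides of a fixed point of [f] ([tame_alternates]). The same holds for all
    the iterates [f^(2^k)], so that for every [k] the orbit is asymptotically
    cut by periodic points into [2^k] blocks which [f] permutes cyclically.
    Two consequences carry the argument.

    - Of the four sub-blocks of a block, the two inner ones are sent to the two
      outer ones by twice the return time. An interval that contains the inner
      ones and stops inside the outer ones, called a frame, therefore covers
      itself strictly ([frame_loop]), and it covers later points of the orbit
      at all times allowed by their residues modulo [2^k] ([frame_live]).

    - An interval that contains two points of the orbit, at times [r < r'],
      has images that contain points on both sides of a periodic point, and
      hence covers a frame; the level of this frame is one more than the
      2-adic valuation of [r' - r] ([segment_covers]).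

    As [x] and [y] are proximal, a frame of [x] also contains many points of
    the orbit of [y] ([frame_visits]), so one passes from either orbit to the
    other. From a frame one can then cover, at one time, the segment between
    [x_r] and [x_r'] and the segment between [y_r] and [y_r'], where [r], [r'] are
    chosen so that both segments are short and far apart. Having the same pair
    of times, they cover frames of the same level, and the residues of the
    times agree, which is what allows them to be synchronised: both cover a
    common short segment of the orbit of [x], which covers a frame again
    ([pair_scrambling]). *)

(** * Infinitely many times *)

Definition often (P : nat -> Prop) := forall N, exists n, (N <= n)%N /\ P n.

Lemma often_sub (P Q : nat -> Prop) :
  (forall n, P n -> Q n) -> often P -> often Q.
Proof. by move=> PQ oP N; have [n [Nn /PQ Qn]] := oP N; exists n. Qed.

Lemma often_or (P Q : nat -> Prop) :
  often (fun n => P n \/ Q n) -> often P \/ often Q.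
Proof.
move=> oPQ; apply: contrapT => /not_orP[/existsNP[M nP] /existsNP[N nQ]].
have [n [Mn [Pn|Qn]]] := oPQ (maxn M N).
- by apply: nP; exists n; split => //; lia.
- by apply: nQ; exists n; split => //; lia.
Qed.

Lemma often_late (P : nat -> Prop) (M : nat) :
  often P -> often (fun n => P n /\ (M <= n)%N).
Proof.
move=> oP N; have [n [Nn Pn]] := oP (maxn M N).
by exists n; split; [lia|split; [by []|lia]].
Qed.

Lemma not_often (P : nat -> Prop) :
  ~ often P -> exists N, forall n, (N <= n)%N -> ~ P n.
Proof.
by move=> /existsNP[N h]; exists N => n Nn Pn; apply: h; exists n.
Qed.

(** Pigeonhole on the residues modulo [m]. *)
Lemma often_residue (P : nat -> Prop) (m : nat) : (0 < m)%N ->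
  often P -> exists r, often (fun n => P n /\ n = r %[mod m]).
Proof.
move=> m0 oP.
suff H : forall k, often (fun n => P n /\ (n %% m < k)%N) ->
    exists r, often (fun n => P n /\ n = r %[mod m]).
  by apply: (H m); apply: often_sub oP => n Pn; split => //; rewrite ltn_mod.
elim=> [oF|k IH oS]; first by have [n [_ []]] := oF 0%N.
have : often (fun n => (P n /\ (n %% m < k)%N) \/ (P n /\ (n %% m = k)%N)).
  apply: often_sub oS => n [Pn]; rewrite ltnS leq_eqVlt => /orP[/eqP|]; tauto.
case/often_or => [/IH //|ok]; exists k; apply: often_sub ok => n [Pn nk].
by split => //; rewrite -nk modn_mod.
Qed.

(** Pigeonhole on a grid of mesh [eta]. *)
Lemma often_close (R : realType) (X : nat -> R) (P : nat -> Prop) (B eta : R) :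
  (forall n, `|X n| <= B) -> 0 < eta -> often P ->
  exists Q, [/\ often Q, forall n, Q n -> P n &
    forall n m, Q n -> Q m -> `|X n - X m| < eta].
Proof.
move=> XB eta0 oP.
suff H : forall k : nat, forall P, often P ->
    (forall n, P n -> X n + B <= k%:R * (eta / 2)) ->
    exists Q, [/\ often Q, forall n, Q n -> P n &
      forall n m, Q n -> Q m -> `|X n - X m| < eta].
  pose k := (Num.truncn (B *+ 2 / (eta / 2))).+1.
  apply: (H k) => // n _; have := XB n; rewrite ler_norml => /andP[_ Xn].
  have : B *+ 2 / (eta / 2) < k%:R.
    exact: truncnS_gt.
  by rewrite ltr_pdivrMr ?divr_gt0// => h; lra.
elim=> [|k IH] {oP}P oP hP.
  exists P; split => // n m /hP; rewrite mul0r => Pn /hP; rewrite mul0r => Pm.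
  move: (XB n) (XB m); rewrite !ler_norml => /andP[? _] /andP[? _].
  by rewrite (_ : X n - X m = 0) ?normr0//; lra.
have : often (fun n => (P n /\ X n + B <= k%:R * (eta / 2)) \/
                       (P n /\ k%:R * (eta / 2) < X n + B)).
  apply: often_sub oP => n Pn.
  by have [h|h] := leP (X n + B) (k%:R * (eta / 2)); [left|right].
case/often_or => [oA|oB].
  have [Q [oQ QP Qc]] := IH _ oA (fun n h => h.2).
  by exists Q; split => // n /QP[].
exists (fun n => P n /\ k%:R * (eta / 2) < X n + B); split => //.
- by move=> n [].
- move=> n m [/hP Pn hn] [/hP Pm hm]; move: Pn Pm; rewrite -natr1 mulrDl mul1r.
  by move=> ? ?; rewrite ltr_norml; apply/andP; split; lra.
Qed.

(** * Real functions *)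

Lemma continuous_dist (R : realType) (f : R -> R) : continuous f ->
  forall x e : R, 0 < e ->
  exists2 d : R, 0 < d & forall y, `|y - x| < d -> `|f y - f x| < e.
Proof.
move=> cf x e e0; have /cvgrPdist_lt/(_ _ e0) := cf x.
case=> d /= d0 h; exists d => // y yx; rewrite distrC; apply: h => /=.
by rewrite distrC.
Qed.

Lemma dist_continuous (R : realType) (f : R -> R) :
  (forall x e : R, 0 < e ->
   exists2 d : R, 0 < d & forall y, `|y - x| < d -> `|f y - f x| < e) ->
  continuous f.
Proof.
move=> cf x; apply/cvgrPdist_lt => e e0; have [d d0 h] := cf x _ e0.
by exists d => //= y /= yx; rewrite distrC; apply: h; rewrite distrC.
Qed.

Lemma iter_continuous (R : realType) (f : R -> R) m :
  continuous f -> continuous (iter m f).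
Proof.
move=> cf; elim: m => [|m IH] x; first exact: cvg_id.
exact: (continuous_comp (IH x) (cf _)).
Qed.

Lemma ivt (R : realType) (f : R -> R) (a b u v z : R) : continuous f ->
  a <= u <= b -> a <= v <= b -> f u <= z <= f v ->
  exists2 c, a <= c <= b & f c = z.
Proof.
move=> cf /andP[au ub] /andP[av vb] /andP[fuz zfv].
have [uv|vu] := leP u v.
  have [] := @IVT R f u v z uv (continuous_subspaceT cf).
    by rewrite ge_min fuz/= le_max zfv orbT.
  by move=> c; rewrite in_itv/= => /andP[? ?] <-; exists c => //; lra.
have [] := @IVT R f v u z (ltW vu) (continuous_subspaceT cf).
  by rewrite ge_min fuz orbT/= le_max zfv.
by move=> c; rewrite in_itv/= => /andP[? ?] <-; exists c => //; lra.
Qed.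

(** * Robust covering relations *)

Definition inI (R : realType) (K : R * R) (x : R) := K.1 <= x <= K.2.

(** Both inequalities are strict, so that a covering survives small
    perturbations of [f]. *)
Definition covers (R : realType) (f : R -> R) (m : nat) (K L : R * R) :=
  exists u v, [/\ inI K u, inI K v, iter m f u < L.1 & L.2 < iter m f v].

Lemma covers_ivt (R : realType) (f : R -> R) m K L (z : R) : continuous f ->
  covers f m K L -> inI L z -> exists2 x, inI K x & iter m f x = z.
Proof.
move=> cf [u [v [Ku Kv fu fv]]] /andP[Lz zL].
by apply: ivt Ku Kv _; [exact: iter_continuous|lra].
Qed.

Lemma covers_trans (R : realType) (f : R -> R) m n K L M : continuous f ->
  covers f m K L -> covers f n L M -> covers f (m + n) K M.
Proof.
move=> cf KL [u [v [Lu Lv fu fv]]].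
have [u' Ku' u'E] := covers_ivt cf KL Lu.
have [v' Kv' v'E] := covers_ivt cf KL Lv.
by exists u', v'; rewrite addnC !iterD u'E v'E.
Qed.

(** * Finite pieces of a nonautonomous system *)

Notation run g n m x := (trajectory (fun i => g (n + i)%N) x m).

Definition onto (R : realType) (g : nat -> R -> R) n m (K L : R * R) :=
  forall z, inI L z -> exists2 x, inI K x & run g n m x = z.

Lemma run_add (R : realType) (g : nat -> R -> R) n m p x :
  run g n (m + p) x = run g (n + m) p (run g n m x).
Proof.
elim: p => [|p IH]; first by rewrite addn0.
by rewrite addnS /= IH addnS addnA addnS.
Qed.

Lemma run_continuous (R : realType) (g : nat -> R -> R) n m :
  (forall i, continuous (g i)) -> continuous (fun x => run g n m x).
Proof.
move=> cg; elim: m => [|m IH] x; first exact: cvg_id.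
exact: (continuous_comp (IH x) (cg _ _)).
Qed.

Definition uniform_cvg (R : realType) (g : nat -> R -> R) (f : R -> R) :=
  forall e : R, 0 < e -> exists N, forall n, (N <= n)%N ->
  forall x, `|g n x - f x| < e.

Lemma run_cvg (R : realType) (g : nat -> R -> R) f m u : continuous f ->
  uniform_cvg g f -> forall e : R, 0 < e -> exists N, forall n, (N <= n)%N ->
  `|run g n m u - iter m f u| < e.
Proof.
move=> cf gf; elim: m => [|m IH] e e0.
  by exists 0%N => n _; rewrite subrr normr0.
have e2 : 0 < e / 2 by rewrite divr_gt0.
have [N1 h1] := gf _ e2.
have [d d0 hd] := continuous_dist cf (iter m f u) e2.
have [N2 h2] := IH _ d0.
exists (maxn N1 N2) => n Nn /=.
have {}h1 := h1 (n + m.+1)%N ltac:(lia) (run g n m u).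
have {}h2 := hd _ (h2 n ltac:(lia)).
by rewrite (splitr e); apply: le_lt_trans (ler_distD _ _ _) (ltrD h1 h2).
Qed.

Lemma onto_trans (R : realType) (g : nat -> R -> R) n m p K L M :
  onto g n m K L -> onto g (n + m) p L M -> onto g n (m + p) K M.
Proof.
move=> KL LM z /LM[y /KL[x Kx xy] yz].
by exists x => //; rewrite run_add xy.
Qed.

(** The endpoints of [L] are passed by two orbit segments of fixed length, and
    these are limits of orbit segments of the nonautonomous system. *)
Lemma covers_onto (R : realType) (g : nat -> R -> R) f m K L : continuous f ->
  (forall n, continuous (g n)) -> uniform_cvg g f -> covers f m K L ->
  exists N, forall n, (N <= n)%N -> onto g n m K L.
Proof.
move=> cf cg gf [u [v [Ku Kv fu fv]]].
have [N1 h1] := run_cvg m u cf gf (ltac:(lra) : 0 < L.1 - iter m f u).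
have [N2 h2] := run_cvg m v cf gf (ltac:(lra) : 0 < iter m f v - L.2).
exists (maxn N1 N2) => n Nn z /andP[Lz zL].
have := h1 n ltac:(lia); have := h2 n ltac:(lia).
rewrite !ltr_norml => /andP[? ?] /andP[? ?].
apply: (ivt (f := fun x => run g n m x)) Ku Kv _; last lra.
exact: run_continuous.
Qed.

(** * From covering relations to scrambled families *)

Definition separated (R : realType) (delta : R) (A B : R * R) :=
  forall a b, inI A a -> inI B b -> delta <= `|a - b|.

(** The intervals [A] and [B] carry the free binary choice, the common target
    [L] makes the orbits that chose differently meet again. *)
Definition scrambling (R : realType) (f : R -> R) (delta : R)
    (Q : R * R -> Prop) :=
  forall K, Q K ->
  (exists2 c, (0 < c)%N & covers f c K K) /\
  forall eta : R, 0 < eta -> exists s s' t A B L K',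
    [/\ covers f s K A /\ covers f s K B,
        covers f s' A L /\ covers f s' B L,
        covers f t L K' /\ Q K',
        L.2 - L.1 < eta & separated delta A B].

(** A checkpoint is an interval together with the time at which it is reached. *)
Definition waiting (R : realType) (g : nat -> R -> R) (Q : R * R -> Prop)
    (S : (R * R) * nat) :=
  Q S.1 /\ exists2 c, (0 < c)%N & forall n, (S.2 <= n)%N -> onto g n c S.1 S.1.

(** In [D = (d, a, b, P, L)], the leg lasts [d] steps, the choice is made after
    [a] steps and the orbits meet after [b] steps. *)
Definition leg (R : realType) (g : nat -> R -> R) (delta eta : R)
    (S S' : (R * R) * nat) (D : nat * nat * nat * (bool -> R * R) * (R * R)) :=
  let: (d, a, b, P, L) := D in
  [/\ (0 < d)%N, S'.2 = (S.2 + d)%N,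
      forall s z, inI S'.1 z -> exists x,
        [/\ inI S.1 x, run g S.2 d x = z, inI (P s) (run g S.2 a x) &
            inI L (run g S.2 b x)],
      L.2 - L.1 < eta & separated delta (P true) (P false)].

Lemma onto_loops (R : realType) (g : nat -> R -> R) T c K :
  (forall n, (T <= n)%N -> onto g n c K K) ->
  forall i n, (T <= n)%N -> onto g n (i * c) K K.
Proof.
move=> loop; elim=> [|i IH] n Tn; first by move=> z Kz; exists z.
rewrite mulSn; apply: onto_trans (loop n Tn) (IH _ _).
exact: leq_trans Tn (leq_addr _ _).
Qed.

(** Each covering of [f] holds for the nonautonomous system only from some time
    on; looping at [K] first is what lets one wait for that time. *)
Lemma next_leg (R : realType) (f : R -> R) (g : nat -> R -> R) (delta eta : R)
    (Q : R * R -> Prop) (S : (R * R) * nat) : continuous f ->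
  (forall n, continuous (g n)) -> uniform_cvg g f ->
  scrambling f delta Q -> 0 < eta -> waiting g Q S ->
  exists S' D, waiting g Q S' /\ leg g delta eta S S' D.
Proof.
move=> cf cg gf scr eta0 [QS [c c0 loop]].
have [_ /(_ _ eta0)] := scr _ QS.
case=> s [s' [t [A [B [L [K' [[KA KB] [AL BL] [LK QK'] Leta sAB]]]]]]].
have [[c' c'0 KK] _] := scr _ QK'.
have [N1 h1] := covers_onto cf cg gf KA.
have [N2 h2] := covers_onto cf cg gf KB.
have [N3 h3] := covers_onto cf cg gf AL.
have [N4 h4] := covers_onto cf cg gf BL.
have [N5 h5] := covers_onto cf cg gf LK.
have [N6 h6] := covers_onto cf cg gf KK.
pose N := maxn (maxn (maxn N1 N2) (maxn N3 N4)) (maxn N5 N6).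
(* [N.+1] rather than [N] loops, so that the leg has positive length. *)
pose w := (N.+1 * c)%N.
have Nw : (N < w)%N by rewrite /w leq_pmulr.
exists (K', (S.2 + (w + s + s' + t))%N).
exists ((w + s + s' + t)%N, (w + s)%N, (w + s + s')%N,
  fun b : bool => if b then A else B, L).
split; first by split => //; exists c' => // n /= Sn; apply: h6; lia.
split => //; first lia.
move=> b z /= Kz.
have [l Ll lz] := h5 (S.2 + (w + s + s'))%N ltac:(lia) z Kz.
have [y Py yl] : exists2 y, inI (if b then A else B) y &
    run g (S.2 + (w + s))%N s' y = l.
  by case: b; [apply: h3|apply: h4] => //; lia.
have [x Kx xy] : exists2 x, inI S.1 x & run g (S.2 + w)%N s x = y.
  by case: b Py => Py; [apply: h1|apply: h2] => //; lia.
have [k Kk kx] := onto_loops loop N.+1 (leqnn _) Kx.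
have ky : run g S.2 (w + s) k = y by rewrite run_add kx.
have kl : run g S.2 (w + s + s') k = l by rewrite run_add ky.
by exists k; split => //; rewrite ?ky ?kl// run_add kl.
Qed.

Lemma nested_closed (R : realType) (K : R * R) (C : nat -> set R) :
  (forall i, closed (C i)) ->
  (forall j, exists x, inI K x /\ forall i, (i < j)%N -> C i x) ->
  exists x, inI K x /\ forall i, C i x.
Proof.
move=> clC /choice[z hz].
have zK : (z @ \oo) `[K.1, K.2]%classic.
  by exists 0%N => // j _ /=; rewrite in_itv/=; exact: (hz j).1.
have [p [Kp clp]] := segment_compact _ zK.
exists p; split; first by move: Kp; rewrite /= in_itv.
move=> i; apply: clC => B pB.
have [|q [Cq Bq]] := clp (C i) B _ pB.
  by exists i.+1 => // j /= ij; exact: (hz j).2.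
by exists q.
Qed.

Lemma inI_closed (R : realType) (K : R * R) (h : R -> R) : continuous h ->
  closed [set x | inI K (h x)].
Proof.
move=> ch; rewrite (_ : [set _ | _] = h @^-1` `[K.1, K.2]%classic).
  by apply: closed_comp => [x _|]; [exact: ch|exact: itv_closed].
by apply/seteqP; split => x /=; rewrite in_itv.
Qed.

(** A sequence of legs, with meeting intervals of lengths tending to 0, is fixed
    once for all; a binary sequence prescribes the choices made along it. For
    finitely many legs a point is found by going backwards through the onto
    maps, for all of them by compactness. *)
Lemma scrambled_family (R : realType) (f : R -> R) (g : nat -> R -> R)
    (delta : R) (Q : R * R -> Prop) (K : R * R) : continuous f ->
  (forall n, continuous (g n)) -> uniform_cvg g f ->
  scrambling f delta Q -> Q K ->
  exists T (x : (nat -> bool) -> R), forall sigma tau,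
    (forall e : R, 0 < e ->
     often (fun n => `|run g T n (x sigma) - run g T n (x tau)| < e)) /\
    (often (fun i => sigma i <> tau i) ->
     often (fun n => delta <= `|run g T n (x sigma) - run g T n (x tau)|)).
Proof.
move=> cf cg gf scr QK.
have [[c c0 KK] _] := scr _ QK.
have [T hT] := covers_onto cf cg gf KK.
pose S0 := (K, T).
have wS0 : waiting g Q S0 by split => //; exists c.
have [F hF] : {F : ((R * R) * nat) * nat -> ((R * R) * nat) *
    (nat * nat * nat * (bool -> R * R) * (R * R)) | forall p,
    waiting g Q p.1 -> waiting g Q (F p).1 /\
    leg g delta (p.2.+1%:R^-1) p.1 (F p).1 (F p).2}.
  have := @choice _ _ (fun (p : ((R * R) * nat) * nat) (q : ((R * R) * nat) *
    (nat * nat * nat * (bool -> R * R) * (R * R))) =>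
    waiting g Q p.1 -> waiting g Q q.1 /\
    leg g delta (p.2.+1%:R^-1) p.1 q.1 q.2).
  case; last by move=> F hF; exists F.
  move=> [S j] /=.
  have [wS|nS] := pselect (waiting g Q S); last by exists (S0, (0, 0, 0, fun=> K, K)%N).
  have [|S' [D [h1 h2]]] := next_leg (eta := j.+1%:R^-1) cf cg gf scr _ wS.
    by rewrite invr_gt0.
  by exists (S', D).
pose st := fix st j := if j is i.+1 then (F (st i, i)).1 else S0.
have wst j : waiting g Q (st j).
  by elim: j => [|j IH] //=; exact: (hF (st j, j) IH).1.
pose D j := (F (st j, j)).2.
have legs j : leg g delta (j.+1%:R^-1) (st j) (st j.+1) (D j).
  exact: (hF (st j, j) (wst j)).2.
pose d j := (D j).1.1.1.1; pose a j := (D j).1.1.1.2; pose b j := (D j).1.1.2.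
pose P j := (D j).1.2; pose L j := (D j).2.
have {}legs j : leg g delta (j.+1%:R^-1) (st j) (st j.+1) (d j, a j, b j, P j, L j).
  by move: (legs j); rewrite /d /a /b /P /L; case: (D j) => [[[[? ?] ?] ?] ?].
pose cl := fix cl j := if j is i.+1 then (cl i + d i)%N else 0%N.
have stT j : (st j).2 = (T + cl j)%N.
  by elim: j => [|j IH]; [rewrite addn0|have [_ -> _ _ _] := legs j; rewrite IH addnA].
have jcl j : (j <= cl j)%N.
  by elim: j => [|j IH] //=; have [d0 _ _ _ _] := legs j; lia.
have fin sigma j z : inI (st j).1 z -> exists x, [/\ inI K x, run g T (cl j) x = z &
    forall i, (i < j)%N -> inI (P i (sigma i)) (run g T (cl i + a i) x) /\
      inI (L i) (run g T (cl i + b i) x)].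
  elim: j z => [|j IH] z; first by move=> Kz; exists z.
  have [_ _ h _ _] := legs j; move=> /(h (sigma j))[y [/IH[x [Kx xy hx]] yz Py Ly]].
  rewrite stT in yz Py Ly.
  exists x; split => //=; first by rewrite run_add xy.
  move=> i; rewrite ltnS leq_eqVlt => /orP[/eqP ->|/hx //].
  by rewrite !run_add xy.
have lim sigma : exists x, inI K x /\ forall i,
    [set x | inI (P i (sigma i)) (run g T (cl i + a i) x)] x /\
    [set x | inI (L i) (run g T (cl i + b i) x)] x.
  apply: (@nested_closed _ K (fun i => _ `&` _)) => [i|j].
    by apply: closedI; apply: inI_closed; exact: run_continuous.
  have [[c' _ [u [_ [Ku _ _ _]]]] _] := scr _ (wst j).1.
  by have [x [Kx _ hx]] := fin sigma j u Ku; exists x.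
have [x hx] := choice lim; exists T, x => sigma tau; split.
  move=> e e0 N; pose j := (N + Num.truncn e^-1)%N.
  exists (cl j + b j)%N; split; first by have := jcl j; lia.
  have [_ /= /andP[l1 l2]] := (hx sigma).2 j.
  have [_ /= /andP[l3 l4]] := (hx tau).2 j.
  have [_ _ _ Lj _] := legs j.
  have je : j.+1%:R^-1 < e.
    rewrite invf_plt ?posrE//; apply: lt_le_trans (truncnS_gt _) _.
    by rewrite ler_nat ltnS leq_addl.
  move: (lt_trans Lj je) => {je}Lj.
  by rewrite ltr_norml; apply/andP; split; lra.
move=> diff N; have [i [Ni si]] := diff N.
exists (cl i + a i)%N; split; first by have := jcl i; lia.
have [/= h1 _] := (hx sigma).2 i; have [/= h2 _] := (hx tau).2 i.
have [_ _ _ _ sep] := legs i.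
case: (sigma i) (tau i) si h1 h2 => [] [] // _ h1 h2; first exact: sep.
by rewrite distrC; exact: sep.
Qed.

(** * Reflection of the line *)

Definition flip (R : realType) (f : R -> R) (x : R) : R := - f (- x).

Lemma flipK (R : realType) : involutive (@flip R).
Proof. by move=> f; apply/funext => x; rewrite /flip !opprK. Qed.

Lemma flip_continuous (R : realType) (f : R -> R) :
  continuous f -> continuous (flip f).
Proof.
move=> cf x; apply: continuousN.
by apply: continuous_comp; [exact: opp_continuous|exact: cf].
Qed.

Lemma iter_flip (R : realType) (f : R -> R) m x :
  iter m (flip f) x = - iter m f (- x).
Proof. by elim: m => [|m IH] /=; rewrite ?IH /flip opprK. Qed.

Lemma covers_flip (R : realType) (f : R -> R) m K L :
  covers (flip f) m K L -> covers f m (- K.2, - K.1) (- L.2, - L.1).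
Proof.
move=> [u [v [/andP[? ?] /andP[? ?]]]]; rewrite !iter_flip => ? ?.
by exists (- v), (- u); split; rewrite /inI /=; lra.
Qed.

(** * Horseshoes *)

Definition left_horseshoe (R : realType) (f : R -> R) :=
  exists b c w, [/\ b < c < w, w <= f b, f c < b & w <= f w].

(** The horseshoes considered are not symmetric: the two intervals [[b, c]] and
    [[c, w]] have images that pass [b] strictly but may end at [w]. *)
Definition horseshoe (R : realType) (f : R -> R) :=
  left_horseshoe f \/ left_horseshoe (flip f).

Lemma horseshoe_flip (R : realType) (f : R -> R) :
  horseshoe (flip f) -> horseshoe f.
Proof. by rewrite /horseshoe flipK or_comm. Qed.

(** Two disjoint intervals, each of which strictly covers the hull of both. *)
Definition robust_horseshoe (R : realType) (f : R -> R) (m : nat) :=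
  exists p1 p2 r1 r2, [/\ p1 <= p2, p2 < r1, r1 <= r2,
    covers f m (p1, p2) (p1, r2) & covers f m (r1, r2) (p1, r2)].

Lemma robust_horseshoe_flip (R : realType) (f : R -> R) m :
  robust_horseshoe (flip f) m -> robust_horseshoe f m.
Proof.
move=> [p1 [p2 [r1 [r2 [h1 h2 h3 /covers_flip/= h4 /covers_flip/= h5]]]]].
by exists (- r2), (- r1), (- p2), (- p1); split => //; lra.
Qed.

(** Inside each of [[b, c]] and [[c, w]], the subinterval that is mapped onto
    [[b, c]] avoids both [c] and [w]; two steps of [f] map it beyond the ends. *)
Lemma left_horseshoe_robust (R : realType) (f : R -> R) : continuous f ->
  left_horseshoe f -> robust_horseshoe f 2.
Proof.
move=> cf [b [c [w [/andP[bc cw] fb fc fw]]]].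
have lt_of (x y : R) : x <= y -> f x <> f y -> x < y.
  by rewrite le_eqVlt => /orP[/eqP ->|].
have [p1 /andP[bp1 p1c] fp1] := ivt cf (ltac:(lra) : b <= c <= c)
  (ltac:(lra) : b <= b <= c) (ltac:(lra) : f c <= c <= f b).
have [p2 /andP[p12 p2c] fp2] := ivt cf (ltac:(lra) : p1 <= c <= c)
  (ltac:(lra) : p1 <= p1 <= c) (ltac:(lra) : f c <= b <= f p1).
have [r2 /andP[cr2 r2w] fr2] := ivt cf (ltac:(lra) : c <= c <= w)
  (ltac:(lra) : c <= w <= w) (ltac:(lra) : f c <= c <= f w).
have [r1 /andP[cr1 r12] fr1] := ivt cf (ltac:(lra) : c <= c <= r2)
  (ltac:(lra) : c <= r2 <= r2) (ltac:(lra) : f c <= b <= f r2).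
have bp1' : b < p1 by apply: lt_of => //; lra.
have r2w' : r2 < w by apply: lt_of => //; lra.
have cr1' : c < r1 by apply: lt_of => //; lra.
exists p1, p2, r1, r2; split; try lra.
- by exists p1, p2; rewrite /inI /= fp1 fp2; split; lra.
- by exists r2, r1; rewrite /inI /= fr1 fr2; split; lra.
Qed.

Lemma horseshoe_robust (R : realType) (f : R -> R) : continuous f ->
  horseshoe f -> robust_horseshoe f 2.
Proof.
move=> cf [|]; first exact: left_horseshoe_robust.
by move=> /(left_horseshoe_robust (flip_continuous cf))/robust_horseshoe_flip.
Qed.

Lemma covers_iter (R : realType) (f : R -> R) m n K L :
  covers (iter m f) n K L -> covers f (n * m) K L.
Proof.
by move=> [u [v [? ? ? ?]]]; exists u, v; split; rewrite // iterM.
Qed.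

(** Bisection: if [L] covers the hull, the image of its midpoint leaves one of
    the two intervals of the horseshoe entirely to one side, so that one half
    of [L] covers that interval and, one round later, the hull. *)
Lemma small_covers (R : realType) (f : R -> R) m p1 p2 r1 r2 : continuous f ->
  p1 <= p2 -> p2 < r1 -> r1 <= r2 ->
  covers f m (p1, p2) (p1, r2) -> covers f m (r1, r2) (p1, r2) ->
  forall eta : R, 0 < eta -> exists t L,
    [/\ covers f t L (p1, r2), L.2 - L.1 < eta, p1 <= L.1 & L.2 <= r2].
Proof.
move=> cf p12 pr r12 Pc Rc eta eta0.
suff H n : exists t L, [/\ covers f t L (p1, r2), L.2 - L.1 <= (r2 - p1) / 2 ^+ n,
    p1 <= L.1 & L.2 <= r2].
  have [n hn] : exists n, (r2 - p1) / 2 ^+ n < eta.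
    exists (Num.truncn ((r2 - p1) / eta)).+1.
    rewrite ltr_pdivrMr ?exprn_gt0// mulrC -ltr_pdivrMr//.
    apply: lt_trans (truncnS_gt _) _.
    by rewrite -natrX ltr_nat ltn_expl.
  by have [t [L [h1 h2 h3 h4]]] := H n; exists t, L; split => //; lra.
elim: n => [|n [t [L [Lc Ln pL Lr]]]].
  exists m, (p1, r2); split => //=; last by rewrite expr0 divr1.
  case: Pc => u [v [/andP[/= ? ?] /andP[/= ? ?] ? ?]].
  by exists u, v; split; rewrite // /inI /=; lra.
have [u [v [/andP[Lu uL] /andP[Lv vL] fu fv]]] := Lc; rewrite /= in fu fv.
have [e eE] : exists e, e = (L.1 + L.2) / 2 by exists ((L.1 + L.2) / 2).
have en : (L.2 - L.1) / 2 <= (r2 - p1) / 2 ^+ n.+1.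
  by rewrite exprSr invfM mulrA ler_pM2r// invr_gt0.
move: (_ / 2 ^+ n.+1) en => q en.
have half x : L.1 <= x <= L.2 -> exists H, [/\ inI H x, inI H e,
    H.2 - H.1 <= q, p1 <= H.1 & H.2 <= r2].
  move=> /andP[Lx xL]; have [xe|ex] := leP x e.
    by exists (L.1, e); split; rewrite /inI /=; lra.
  by exists (e, L.2); split; rewrite /inI /=; lra.
have [ye|ey] := ltP p2 (iter t f e).
  have [H [Hu He Hn pH Hr]] := half u ltac:(lra).
  exists (t + m)%N, H; split => //; apply: covers_trans Pc => //.
  by exists u, e.
have [H [Hv He Hn pH Hr]] := half v ltac:(lra).
exists (t + m)%N, H; split => //; apply: covers_trans Rc => //.
by exists e, v; split => //=; lra.
Qed.

Lemma horseshoe_scrambling (R : realType) (f : R -> R) k : continuous f ->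
  (0 < k)%N -> horseshoe (iter k f) ->
  exists delta Q K, [/\ 0 < delta, scrambling f delta Q & Q K].
Proof.
move=> cf k0 /(horseshoe_robust (@iter_continuous _ _ k cf)).
case=> p1 [p2 [r1 [r2 [p12 pr r12 /covers_iter Pc /covers_iter Rc]]]].
exists (r1 - p2), (fun K => K = (p1, r2)), (p1, r2); split => //; first lra.
move=> _ ->.
have widen s A L : p1 <= L.1 -> L.2 <= r2 -> covers f s A (p1, r2) -> covers f s A L.
  by move=> ? ? [u [v [? ? /= ? ?]]]; exists u, v; split => //; lra.
have QQ : covers f (2 * k) (p1, r2) (p1, r2).
  have [u [v [/andP[/= ? ?] /andP[/= ? ?] ? ?]]] := Pc.
  by exists u, v; split; rewrite // /inI /=; lra.
split; first by exists (2 * k)%N => //; rewrite muln_gt0.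
move=> eta eta0.
have [t [L [Lc Leta pL Lr]]] := small_covers cf p12 pr r12 Pc Rc eta0.
exists (2 * k)%N, (2 * k)%N, t, (p1, p2), (r1, r2), L, (p1, r2).
split => //.
- by split; apply: widen QQ => /=; lra.
- by split; apply: widen; [| |exact: Pc| | |exact: Rc].
- move=> a b /andP[/= ? ?] /andP[/= ? ?].
  by rewrite distrC; apply: le_trans (ler_norm _); lra.
Qed.

(** * Orbits that are not asymptotically periodic *)

Definition nonconvergent (R : realType) (X : nat -> R) :=
  forall l, exists2 e : R, 0 < e & often (fun n => e <= `|X n - l|).

(** The standing assumption of the case without horseshoes. Powers of 2 suffice
    as periods, since they are the only ones at which the orbit is cut. *)
Definition tame (R : realType) (f : R -> R) (x : R) :=
  [/\ continuous f, exists B, forall n, `|iter n f x| <= B,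
      forall k, ~ horseshoe (iter (2 ^ k) f) &
      forall k, nonconvergent (fun n => iter (n * 2 ^ k) f x)].

Lemma nonconvergent_comp (R : realType) (f : R -> R) (X : nat -> R) :
  continuous f -> nonconvergent (fun n => f (X n)) -> nonconvergent X.
Proof.
move=> cf ncX l; have [e e0 oe] := ncX (f l).
have [d d0 hd] := continuous_dist cf l e0.
exists d => //; apply: often_sub oe => n; rewrite leNgt => /negP h.
by rewrite leNgt; apply/negP => /hd.
Qed.

Lemma nonconvergent_shift (R : realType) (X : nat -> R) m :
  nonconvergent X -> nonconvergent (fun n => X (n + m)%N).
Proof.
move=> ncX l; have [e e0 oe] := ncX l; exists e => // N.
have [n [Nn en]] := oe (N + m)%N.
by exists (n - m)%N; split; [lia|rewrite subnK//; lia].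
Qed.

(** Convergence of the shifted progression would carry over to the original one
    under a further iterate of [f]. *)
Lemma tame_next (R : realType) (f : R -> R) x m :
  tame f x -> tame f (iter m f x).
Proof.
move=> [cf [B hB] nH nc]; split => //.
  by exists B => n; rewrite -iterD.
move=> k; apply: (@nonconvergent_comp _ (iter (m * 2 ^ k - m) f)).
  exact: iter_continuous.
rewrite (_ : (fun n => _) = (fun n => iter ((n + m) * 2 ^ k) f x)).
  exact: (nonconvergent_shift m (nc k)).
apply/funext => n; rewrite -!iterD; congr iter.
by have : (0 < 2 ^ k)%N := expn_gt0 2 k; nia.
Qed.

Lemma tame_iter (R : realType) (f : R -> R) x k :
  tame f x -> tame (iter (2 ^ k) f) x.
Proof.
move=> [cf [B hB] nH nc]; split.
- exact: iter_continuous.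
- by exists B => n; rewrite -iterM.
- move=> j; rewrite (_ : iter _ _ = iter (2 ^ (j + k)) f); first exact: nH.
  by apply/funext => y; rewrite -iterM -expnD.
- move=> j; rewrite (_ : (fun n => _) = (fun n => iter (n * 2 ^ (j + k)) f x)).
    exact: nc.
  by apply/funext => n; rewrite -iterM -mulnA -expnD.
Qed.

Lemma tame_flip (R : realType) (f : R -> R) x :
  tame f x -> tame (flip f) (- x).
Proof.
move=> [cf [B hB] nH nc]; split.
- exact: flip_continuous.
- by exists B => n; rewrite iter_flip opprK normrN.
- move=> j; rewrite (_ : iter _ _ = flip (iter (2 ^ j) f)).
    by move=> /horseshoe_flip; exact: nH.
  by apply/funext => y; rewrite iter_flip.
- move=> j l; have [e e0 oe] := nc j (- l); exists e => //.
  apply: often_sub oe => n; rewrite iter_flip opprK.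
  by rewrite -opprD normrN opprK.
Qed.

Lemma not_eventually_up (R : realType) (X : nat -> R) (B : R) (N : nat) :
  nonconvergent X -> (forall n, `|X n| <= B) ->
  ~ forall n, (N <= n)%N -> X n <= X n.+1.
Proof.
move=> ncX hB up.
have mono m n : (N <= m)%N -> (m <= n)%N -> X m <= X n.
  move=> Nm; elim: n => [|n IH]; first by rewrite leqn0 => /eqP ->.
  rewrite leq_eqVlt => /orP[/eqP -> //|]; rewrite ltnS => mn.
  by apply: le_trans (IH mn) (up n _); lia.
pose E := [set X n | n in [set n | (N <= n)%N]].
have hE : has_sup E.
  split; first by exists (X N), N => //=.
  by exists B => _ [n _ <-]; exact: le_trans (ler_norm _) (hB n).
have [e e0 oe] := ncX (sup E).
have [_ [m /= Nm <-] Xm] := sup_adherent e0 hE.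
have [n [mn]] := oe m; rewrite leNgt => /negP; apply.
have := mono m n Nm mn.
have : X n <= sup E by apply: sup_upper_bound => //; exists n => //=; lia.
by move=> ? ?; rewrite ltr_norml; apply/andP; split; lra.
Qed.

(** * Orbits turn around a fixed point *)

(** Suppose that the orbit goes down at [X j], and later goes up at [X i > X j],
    with [i - j] minimal. In between, the points below [X i] go up and lie below
    [X j], by minimality. So the orbit climbs from [X j.+1] until it jumps from
    below [X j] to above [X i]. Between [X j] and [X i] there is a fixed point
    [w], and the last point before the jump lies left of [X j] and is sent
    beyond [w]: this yields the point [b]. *)
Lemma down_up_horseshoe (R : realType) (f : R -> R) x : continuous f ->
  (forall n, iter n f x <> iter n.+1 f x) ->
  forall j i, (j < i)%N -> iter j.+1 f x < iter j f x ->
  iter i f x < iter i.+1 f x -> iter j f x < iter i f x -> left_horseshoe f.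
Proof.
move=> cf mov j i; move mE : (i - j)%N => m.
elim/ltn_ind: m i j mE => m IH i j mE ji.
set X := fun n => iter n f x; rewrite -/(X j) -/(X i) -/(X j.+1) -/(X i.+1).
move=> dj ui Xji.
have XS n : X n.+1 = f (X n) by [].
have [[l /and4P[jl li dl Xl]]|nl1] :=
  pselect (exists l, [&& (j < l)%N, (l < i)%N, X l.+1 < X l & X l < X i]).
  by apply: (IH (i - l)%N _ i l) => //; lia.
have [[l /and4P[jl li ul Xl]]|nl2] :=
  pselect (exists l, [&& (j < l)%N, (l < i)%N, X l < X l.+1 & X j < X l]).
  by apply: (IH (l - j)%N _ l j) => //; lia.
have inner l : (j < l < i)%N -> X l < X i -> X l < X l.+1 /\ X l < X j.
  move=> /andP[jl li] Xl; have ul : X l < X l.+1.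
    rewrite ltNge le_eqVlt; apply/negP => /orP[/eqP e|dl].
      by apply: (mov l); rewrite -/(X l) -/(X l.+1) e.
    by apply: nl1; exists l; rewrite jl li dl Xl.
  split => //; rewrite ltNge le_eqVlt; apply/negP => /orP[/eqP e|Xjl].
    by move: ul; rewrite XS -e -XS ltNge (ltW dj).
  by apply: nl2; exists l; rewrite jl li ul Xjl.
have : exists n, (j < n)%N && (X i <= X n) by exists i; rewrite ji lexx.
case/ex_minnP => l /andP[jl Xil] lmin.
have li : (l <= i)%N by apply: lmin; rewrite ji lexx.
have before t : (j < t < l)%N -> X t < X i.
  move=> /andP[jt tl]; rewrite ltNge; apply/negP => Xit.
  by have := lmin t; rewrite jt Xit => /(_ isT); lia.
have jSl : (j.+1 < l)%N.
  rewrite ltn_neqAle jl andbT; apply/eqP => jSl.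
  by move: Xil; rewrite -jSl leNgt (lt_trans dj Xji).
have incr t : (j < t < l)%N -> X j.+1 <= X t.
  elim: t => [|t IHt] //; rewrite ltnS leq_eqVlt => /andP[/orP[/eqP -> //|jt] tl].
  have jtl : (j < t < l)%N by lia.
  have [ut _] := inner t ltac:(lia) (before t jtl).
  exact: le_trans (IHt jtl) (ltW ut).
have {IH mE}[ul uz] := inner l.-1 ltac:(lia) (before l.-1 ltac:(lia)).
have vu := incr l.-1 ltac:(lia).
have fu : f (X l.-1) = X l by rewrite -XS prednK//; lia.
have cid : continuous (fun y => f y - y).
  by move=> y; apply: continuousB; [exact: cf|exact: cvg_id].
have [w /andP[zw wy] fw] := ivt cid (ltac:(lra) : X j <= X j <= X i)
  (ltac:(lra) : X j <= X i <= X i)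
  (ltac:(rewrite -!XS; lra) : f (X j) - X j <= 0 <= f (X i) - X i).
have {}fw : f w = w by lra.
have wi : w <> X i by move=> wi; move: fw; rewrite wi -XS => ?; lra.
have wj : w <> X j by move=> wj; move: fw; rewrite wj -XS => ?; lra.
have [b /andP[ub bz] fb] := ivt cf (ltac:(lra) : X l.-1 <= X j <= X j)
  (ltac:(lra) : X l.-1 <= X l.-1 <= X j)
  (ltac:(rewrite -XS fu; lra) : f (X j) <= w <= f (X l.-1)).
have bu : b <> X l.-1.
  by move=> bu; apply: wi; move: fb; rewrite bu fu; lra.
have bzn : b <> X j by move=> bj; move: fb; rewrite bj -XS; lra.
exists b, (X j), w; rewrite -XS fb fw; split; lra.
Qed.

Lemma tame_nonconvergent (R : realType) (f : R -> R) x :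
  tame f x -> nonconvergent (fun n => iter n f x).
Proof.
by move=> [_ _ _ /(_ 0%N)]; congr nonconvergent; apply/funext => n; rewrite muln1.
Qed.

Lemma tame_moves (R : realType) (f : R -> R) x n :
  tame f x -> iter n f x <> iter n.+1 f x.
Proof.
move=> /tame_nonconvergent nc fix_n; have [e e0 oe] := nc (iter n f x).
have [m [nm]] := oe n; rewrite (_ : iter m f x = iter n f x).
  by rewrite subrr normr0 leNgt e0.
rewrite -(subnK nm); elim: (m - n)%N => [|i IH] //.
by rewrite addSn iterS IH -iterS fix_n.
Qed.

Lemma sup_ge0 (R : realType) (h : R -> R) (E : set R) : continuous h ->
  has_sup E -> (forall x, E x -> 0 <= h x) -> 0 <= h (sup E).
Proof.
move=> ch hE hpos; rewrite leNgt; apply/negP => hneg.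
have [d d0 hd] := continuous_dist ch (sup E) (ltac:(lra) : 0 < - h (sup E)).
have [y Ey yd] := sup_adherent d0 hE.
have yE := sup_upper_bound hE Ey.
have := hd y ltac:(rewrite ltr_norml; apply/andP; split; lra).
by have := hpos y Ey; rewrite ltr_norml => ? /andP[? ?]; lra.
Qed.

(** The case where the down step comes first is [down_up_horseshoe]; reflection
    exchanges it with the other case. *)
Lemma up_below_down (R : realType) (f : R -> R) x i j : tame f x ->
  iter i f x < iter i.+1 f x -> iter j.+1 f x < iter j f x ->
  iter i f x < iter j f x.
Proof.
move=> tx ui dj; have [cf _ /(_ 0%N) nH _] := tx.
rewrite ltNge; apply/negP; rewrite le_eqVlt => /orP[/eqP e|Xji].
  by move: ui dj; rewrite !iterS e => ? ?; lra.
case: (ltngtP i j) => [ij|ji|ij]; last by move: Xji; rewrite ij ltxx.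
  have tx' := tame_flip tx; apply: nH; right.
  have mov n := @tame_moves _ _ _ n tx'.
  by apply: (down_up_horseshoe (flip_continuous cf) mov ij);
    rewrite !iter_flip !opprK ltrN2.
apply: nH; left; apply: (down_up_horseshoe cf) ji dj ui Xji => n.
exact: tame_moves.
Qed.

Definition turns (R : realType) (f : R -> R) (x w : R) :=
  f w = w /\ forall n,
    (iter n f x < w /\ iter n f x < iter n.+1 f x) \/
    (w < iter n f x /\ iter n.+1 f x < iter n f x).

(** All points that go up lie below all points that go down, and [f y - y]
    changes sign between the supremum of the former and the infimum of the
    latter. *)
Lemma tame_turns (R : realType) (f : R -> R) x : tame f x -> exists w, turns f x w.
Proof.
move=> tx; have [cf [B hB] _ _] := tx; have nc := tame_nonconvergent tx.
pose X n := iter n f x.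
have ud n : X n < X n.+1 \/ X n.+1 < X n.
  have := tame_moves (n := n) tx; rewrite -/(X n) -/(X n.+1) => ne.
  by have [?|?|] := ltgtP (X n) (X n.+1); [left|right|].
have [i ui] : exists i, X i < X i.+1.
  apply: contrapT => /forallNP none.
  have nc' := tame_nonconvergent (tame_flip tx).
  apply: (not_eventually_up (N := 0) nc') => [n|n _].
    by rewrite iter_flip opprK normrN; exact: hB.
  by rewrite !iter_flip opprK lerN2; have [/none|/ltW] := ud n.
have [j dj] : exists j, X j.+1 < X j.
  apply: contrapT => /forallNP none.
  by apply: (not_eventually_up (N := 0) nc hB) => n _; have [/ltW|/none] := ud n.
pose U := [set X n | n in [set n | X n < X n.+1]].
pose D := [set - X n | n in [set n | X n.+1 < X n]].
have supU : has_sup U.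
  split; first by exists (X i), i.
  by exists B => _ [n _ <-]; exact: le_trans (ler_norm _) (hB n).
have supD : has_sup D.
  split; first by exists (- X j), j.
  by exists B => _ [n _ <-]; apply: le_trans (ler_norm _) _; rewrite normrN; exact: hB.
have cid : continuous (fun y => f y - y).
  by move=> y; apply: continuousB; [exact: cf|exact: cvg_id].
have hU : 0 <= f (sup U) - sup U.
  by apply: (sup_ge0 cid supU) => _ [n /= un <-]; rewrite subr_ge0 -iterS ltW.
have hD : 0 <= flip (fun y => f y - y) (sup D).
  apply: (sup_ge0 (flip_continuous cid) supD) => _ [n /= dn <-].
  by rewrite /flip opprK oppr_ge0 subr_le0 -iterS ltW.
have UD : sup U <= - sup D.
  apply: sup_le_ub supU.1 _ => _ [n /= un <-]; rewrite lerNr.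
  apply: sup_le_ub supD.1 _ => _ [m /= dm <-]; rewrite lerN2 ltW//.
  exact: up_below_down.
have hD' : f (- sup D) - - sup D <= 0 by rewrite /flip oppr_ge0 in hD.
have XU n : X n < X n.+1 -> X n <= sup U.
  by move=> un; apply: sup_upper_bound => //; exists n.
have XD n : X n.+1 < X n -> - sup D <= X n.
  by move=> dn; rewrite lerNl; apply: sup_upper_bound => //; exists n.
move: (sup U) (- sup D) hU hD' UD XU XD => u v hu hv uv Xu Xv {hD supU supD}.
have [w /andP[uw wv] fw] := ivt cid (ltac:(lra) : u <= v <= v)
  (ltac:(lra) : u <= u <= v) (ltac:(lra) : f v - v <= 0 <= f u - u).
have {}fw : f w = w by lra.
exists w; split => // n; rewrite -/(X n) -/(X n.+1).
have nw : X n <> w.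
  by move=> e; apply: (tame_moves (n := n) tx); rewrite iterS -/(X n) e.
have [un|dn] := ud n; [left|right]; split => //.
- by have := Xu n un; lra.
- by have := Xv n dn; lra.
Qed.

Lemma turns_flip (R : realType) (f : R -> R) x w :
  turns f x w -> turns (flip f) (- x) (- w).
Proof.
move=> [fw h]; split; first by rewrite /flip opprK fw.
by move=> n; rewrite !iter_flip opprK; have [[? ?]|[? ?]] := h n; [right|left]; lra.
Qed.

(** * Orbits eventually alternate around the fixed point *)

(** The points right of [w] that the orbit reaches are images of points of
    [[d, w]]. If one of them were sent below [d], then [d], its preimage and [w]
    would form a horseshoe of [f^2], as [f^2 d = w]. *)
Lemma stays_above (R : realType) (f : R -> R) x w d m0 : continuous f ->
  ~ left_horseshoe (iter 2 f) -> turns f x w -> f d = w ->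
  d <= iter m0 f x < w -> forall m, (m0 <= m)%N -> d <= iter m f x.
Proof.
move=> cf nH [fw side] fd /andP[dm0 m0w].
suff H m : (m0 <= m)%N -> d <= iter m f x /\
    (w < iter m f x -> exists2 s, d <= s <= w & f s = iter m f x).
  by move=> m /H[].
elim: m => [|m IH]; first by rewrite leqn0 => /eqP <-; split => // ?; lra.
rewrite leq_eqVlt => /orP[/eqP <-|]; first by split => // ?; lra.
rewrite ltnS => /IH[dm hm].
have [[mw um]|[wm dn]] := side m.
  split; first by lra.
  by move=> _; exists (iter m f x) => //; lra.
have [s /andP[ds sw] fs] := hm wm.
have sd : s <> d by move=> e; move: wm; rewrite -fs e fd ltxx.
have sw' : s <> w by move=> e; move: wm; rewrite -fs e fw ltxx.
split.
  rewrite leNgt; apply/negP => lt_d; apply: nH; exists d, s, w.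
  by rewrite /= fd fw fs; split => //; lra.
move=> wm1; have [t /andP[st tw] ft] := ivt cf (ltac:(lra) : s <= w <= w)
  (ltac:(lra) : s <= s <= w) (ltac:(rewrite fw fs; lra) : f w <= iter m.+1 f x <= f s).
by exists t => //; lra.
Qed.

(** Call a pause a time at which the orbit stays left of [w] once before it
    crosses. Between the two points of a pause lies a preimage [d] of [w], and by
    [stays_above] the orbit never returns below [d]. So the points of the orbit
    at its pauses increase to a limit [l] with [f l = w]. If [l < w], the point after a late pause lies in
    [[l, w]], and the orbit stays above [l], hence has no further pause. If
    [l = w], the left points converge to [w], and so do the right points, which
    decrease until the next crossing: the orbit converges. *)
Lemma finitely_many_pauses (R : realType) (f : R -> R) x w :
  tame f x -> turns f x w ->
  ~ often (fun n => [/\ iter n f x < w, iter n.+1 f x < w & w < iter n.+2 f x]).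
Proof.
move=> tx tw; have [cf [B hB] /(_ 1%N) nH _] := tx.
have {}nH : ~ left_horseshoe (iter 2 f) by move=> h; apply: nH; left.
have nc := tame_nonconvergent tx; have [fw side] := tw.
pose X n := iter n f x.
pose Z n := [/\ X n < w, X n.+1 < w & w < X n.+2].
move=> oZ; rewrite -/(often Z) in oZ.
have barrier n : Z n -> exists d, [/\ X n < d, f d = w &
    forall m, (n < m)%N -> d <= X m].
  move=> [nw nw1 nw2].
  have un : X n < X n.+1 by have [[]|[]] := side n; rewrite -/(X n) -/(X n.+1) => ? ?; lra.
  have [d /andP[Xd dX] fd] := ivt cf (ltac:(lra) : X n <= X n <= X n.+1)
    (ltac:(lra) : X n <= X n.+1 <= X n.+1)
    (ltac:(rewrite -!iterS -/(X n.+1) -/(X n.+2); lra) : f (X n) <= w <= f (X n.+1)).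
  have dn : d <> X n.
    by move=> e; move: fd; rewrite e -iterS -/(X n.+1) => ?; lra.
  exists d; split => //; first by lra.
  by apply: (stays_above cf nH tw fd); rewrite -/(X n.+1); lra.
pose E := [set X n | n in [set n | Z n]].
have supE : has_sup E.
  have [n [_ Zn]] := oZ 0%N; split; first by exists (X n), n.
  by exists B => _ [m _ <-]; exact: le_trans (ler_norm _) (hB m).
set l := sup E in supE *.
have below n : Z n -> X n <= l by move=> Zn; apply: sup_upper_bound => //; exists n.
have next n d : Z n -> (forall m, (n < m)%N -> d <= X m) -> d <= l.
  move=> Zn hd; have [m [nm Zm]] := oZ n.+1.
  exact: le_trans (hd m nm) (below m Zm).
have close e : 0 < e -> exists n, Z n /\ l - e < X n.
  by move=> e0; have [_ [n /= Zn <-] en] := sup_adherent e0 supE; exists n.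
have lw : l <= w by apply: sup_le_ub supE.1 _ => _ [n [? _ _] <-]; lra.
have fl : f l = w.
  apply/eqP; rewrite -subr_eq0 -normr_le0 leNgt; apply/negP => e0.
  have [d d0 hd] := continuous_dist cf l e0.
  have [n [Zn nl]] := close _ d0; have [b [nb fb hb]] := barrier n Zn.
  have bl := next n b Zn hb.
  have := hd b ltac:(by rewrite ltr_norml; apply/andP; split; lra).
  by rewrite fb distrC ltxx.
have {lw}[lw|lw] := ltP l w.
  have [d d0 hd] := continuous_dist cf l (ltac:(lra) : 0 < w - l).
  have [n [Zn nl]] := close _ d0; have [b [nb fb hb]] := barrier n Zn.
  have bl := next n b Zn hb; have [nw nw1 nw2] := Zn.
  have := hd (X n) ltac:(by rewrite ltr_norml; apply/andP; split; lra).
  rewrite fl -iterS -/(X n.+1) ltr_norml => /andP[? ?].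
  have stay := stays_above cf nH tw fl (m0 := n.+1) ltac:(rewrite -/(X n.+1); lra).
  have [m [nm Zm]] := oZ n.+1; have [c [mc _ hc]] := barrier m Zm.
  by have := next m c Zm hc; have := stay m nm; rewrite -/(X m) => ? ?; lra.
have [e e0 oe] := nc w; have [d d0 hd] := continuous_dist cf w e0.
have [n [Zn nl]] := close (Num.min d e) ltac:(by rewrite lt_min d0).
have [b [nb fb hb]] := barrier n Zn; have [nw nw1 nw2] := Zn.
have [bd be] : w - d < b /\ w - e < b.
  by move: nl; rewrite ltrBlDr -ltrBlDl lt_min => /andP[? ?]; split; lra.
suff near m : (n < m)%N -> `|X m - w| < e.
  by have [m [nm]] := oe n.+1; rewrite leNgt => /negP; apply; exact: near.
elim: m => [|m IH] //; rewrite ltnS leq_eqVlt => /orP[/eqP <-|nm].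
  by have := hb n.+1 (ltnSn n) => ?; rewrite ltr_norml; apply/andP; split; lra.
have bm := hb m nm; have bm1 := hb m.+1 ltac:(lia).
have : (X m < w) \/ (w < X m /\ X m.+1 < X m) by have [[? _]|] := side m; [left|right].
case=> [mw|[wm dm]].
  rewrite /X iterS -/(X m) -{1}fw; apply: hd.
  by rewrite ltr_norml; apply/andP; split; lra.
move: (IH nm); rewrite !ltr_norml => /andP[? ?].
by apply/andP; split; lra.
Qed.

Lemma eventually_right (R : realType) (f : R -> R) x w : tame f x ->
  turns f x w -> exists N, forall n, (N <= n)%N ->
  iter n f x < w -> w < iter n.+1 f x.
Proof.
move=> tx tw; have [N hN] := not_often (finitely_many_pauses tx tw).
exists N => n Nn nw; have [_ side] := tw.
have [[nw1 _]|[]//] := side n.+1.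
have [cf [B hB] _ _] := tx.
have stay m : (n <= m)%N -> iter m f x < w /\ iter m.+1 f x < w.
  elim: m => [|m IH]; first by rewrite leqn0 => /eqP <-.
  rewrite leq_eqVlt => /orP[/eqP <- //|]; rewrite ltnS => nm.
  have [mw mw1] := IH nm; split => //.
  have [[]//|[mw2 _]] := side m.+2.
  by exfalso; apply: (hN m ltac:(lia)).
exfalso; apply: (not_eventually_up (N := n) (tame_nonconvergent tx) hB) => m nm.
have [mw _] := stay m nm.
by have [[_ /ltW]//|[wm _]] := side m; lra.
Qed.

Lemma tame_alternates (R : realType) (f : R -> R) x w : tame f x ->
  turns f x w -> exists N, forall n, (N <= n)%N ->
  (iter n f x < w /\ w < iter n.+1 f x) \/ (w < iter n f x /\ iter n.+1 f x < w).
Proof.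
move=> tx tw; have [N1 h1] := eventually_right tx tw.
have [N2 h2] := eventually_right (tame_flip tx) (turns_flip tw).
exists (maxn N1 N2) => n Nn.
have [[nw _]|[wn _]] := tw.2 n; [left|right]; split => //.
  by apply: h1 => //; lia.
have := h2 n ltac:(lia); rewrite !iter_flip !opprK !ltrN2; exact.
Qed.

(** * Frames *)

(** Here [[w1, w2]] separates the inner sub-blocks from the outer ones: of two
    times that differ by 2, at least one belongs to an inner sub-block. *)
Definition frame (R : realType) (f : R -> R) (x : R) (Q : R * R) :=
  exists w1 w2 n0, [/\ [/\ Q.1 < w1, w1 <= w2 & w2 < Q.2],
    forall n, (n0 <= n)%N ->
      w1 <= iter n f x <= w2 \/ w1 <= iter n.+2 f x <= w2,
    often (fun n => iter n f x < Q.1) & often (fun n => Q.2 < iter n f x)].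

Lemma alternates_even (R : realType) (f : R -> R) x w N :
  (forall n, (N <= n)%N -> (iter n f x < w /\ w < iter n.+1 f x) \/
     (w < iter n f x /\ iter n.+1 f x < w)) ->
  forall n, (N <= n)%N -> forall i,
  (iter n f x < w -> iter (n + i.*2) f x < w) /\
  (w < iter n f x -> w < iter (n + i.*2) f x).
Proof.
move=> alt n Nn; elim=> [|i [IH1 IH2]]; first by rewrite addn0.
have /= h1 := alt (n + i.*2)%N ltac:(lia).
have /= h2 := alt (n + i.*2).+1 ltac:(lia).
by rewrite doubleS !addnS /=; split => [/IH1|/IH2] ?; lra.
Qed.

(** The points of the orbit that lie below [w1] form an orbit of [f^2] which does
    not converge to [w1]; hence infinitely many of them stay away from [w1]. *)
Lemma lower_frame (R : realType) (f : R -> R) x w : tame f x ->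
  (forall n, iter n f x < w) ->
  exists a w1 n0, [/\ a < w1, w1 < w, often (fun n => iter n f x < a) &
    forall n, (n0 <= n)%N -> w1 < iter n f x \/ w1 < iter n.+1 f x].
Proof.
move=> tx xw; have [w1 tw1] := tame_turns tx.
have [N alt] := tame_alternates tx tw1.
have [b Nb bw] : exists2 b, (N <= b)%N & iter b f x < w1.
  by have [[? _]|[_ ?]] := alt N (leqnn N); [exists N|exists N.+1].
have [e e0 oe] := tame_nonconvergent (tame_iter 1 (tame_next b tx)) w1.
exists (w1 - e / 2), w1, N; split.
- lra.
- have [[_ h]|[h _]] := alt N (leqnn N); exact: lt_trans h (xw _).
- move=> M; have [n [Mn]] := oe M; rewrite -iterM -iterD expn1 muln2 => en.
  exists (n.*2 + b)%N; split; first lia.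
  have [/(_ bw) + _] := alternates_even alt Nb n; rewrite addnC.
  by move: en; rewrite ler_normr => /orP[] ? ?; lra.
- by move=> n Nn; have [[_ h]|[h _]] := alt n Nn; [right|left].
Qed.

(** The even and the odd times of the orbit live on different sides of [w], and
    both are orbits of [f^2]; splitting each of them once more gives the four
    sub-blocks. *)
Lemma tame_frame (R : realType) (f : R -> R) x : tame f x ->
  exists Q, frame f x Q.
Proof.
move=> tx; have [w tw] := tame_turns tx.
have [N alt] := tame_alternates tx tw; have even := alternates_even alt.
have [a Na [aw wa]] : exists2 a, (N <= a)%N & iter a f x < w /\ w < iter a.+1 f x.
  have [[? ?]|[_ ?]] := alt N (leqnn N); first by exists N.
  by exists N.+1 => //; have [[]|[]] := alt N.+1 (leqnSn N) => ? ?; lra.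
have [|al [w1 [n1 [al1 w1w oal h1]]]] :=
  lower_frame (w := w) (tame_iter 1 (tame_next a tx)).
  move=> n; rewrite -iterM -iterD expn1 muln2 addnC.
  exact: (even a Na n).1.
have [|be [w2 [n2 [be2 w2w obe h2]]]] :=
  lower_frame (w := - w) (tame_flip (tame_iter 1 (tame_next a.+1 tx))).
  move=> n; rewrite iter_flip opprK ltrN2 -iterM -iterD expn1 muln2 addnC.
  by apply: (even a.+1 _ n).2 => //; lia.
exists (al, - be), w1, (- w2), (a.+1 + (maxn n1 n2).*2)%N; split => /=.
- by split; lra.
- move=> n an; rewrite -!iterS; have [p [i [nE ip]]] : exists (p : bool) i,
      n = (a + p + i.*2)%N /\ (maxn n1 n2 <= i)%N.
    have := odd_double_half (n - a); move: (_./2) => h.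
    by case: (odd _) => /= nE; [exists true, h|exists false, h]; split; lia.
  case: p nE => nE.
    have ip' : (n2 <= i)%N by lia.
    have := h2 i ip'; rewrite !iter_flip !opprK -!iterM -!iterD expn1 !muln2.
    have := (even a.+1 ltac:(lia) i).2 wa; have := (even a.+1 ltac:(lia) i.+1).2 wa.
    rewrite (_ : (a.+1 + i.*2)%N = n); last lia.
    rewrite (_ : (i.*2 + a.+1)%N = n); last lia.
    rewrite (_ : (a.+1 + i.+1.*2)%N = n.+2); last lia.
    rewrite (_ : (i.+1.*2 + a.+1)%N = n.+2); last lia.
    by move=> ? ? [?|?]; [left|right]; lra.
  have ip' : (n1 <= i)%N by lia.
  have := h1 i ip'; rewrite -!iterM -!iterD expn1 !muln2.
  have := (even a ltac:(lia) i).1 aw; have := (even a ltac:(lia) i.+1).1 aw.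
  rewrite (_ : (a + i.*2)%N = n); last lia.
  rewrite (_ : (i.*2 + a)%N = n); last lia.
  rewrite (_ : (a + i.+1.*2)%N = n.+2); last lia.
  rewrite (_ : (i.+1.*2 + a)%N = n.+2); last lia.
  by move=> ? ? [?|?]; [left|right]; lra.
- move=> M; have [n [Mn]] := oal M; rewrite -iterM -iterD => h.
  by exists (n * 2 ^ 1 + a)%N; split => //; lia.
- move=> M; have [n [Mn]] := obe M; rewrite iter_flip opprK -iterM -iterD => h.
  by exists (n * 2 ^ 1 + a.+1)%N; split; [lia|lra].
Qed.

Lemma frame_ordered (R : realType) (f : R -> R) x Q : frame f x Q -> Q.1 < Q.2.
Proof. by move=> [w1 [w2 [_ [[? ? ?] _ _ _]]]]; lra. Qed.

(** * Segments between two points of an orbit *)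

(** At all late times the image of a segment whose ends differ by an odd time
    contains [w], because its ends lie on different sides of [w]. The frame is
    taken in the block to the right of [w], so that it suffices to choose a time
    at which one end passes the upper end of the frame. *)
Lemma odd_segment_covers (R : realType) (f : R -> R) x m : tame f x -> odd m ->
  exists Q t c, [/\ frame (iter 2 f) (iter c f x) Q, c = t %[mod 2] &
    forall K, inI K x -> inI K (iter m f x) -> covers f t K Q].
Proof.
move=> tx om; have [w tw] := tame_turns tx.
have [N alt] := tame_alternates tx tw; have even := alternates_even alt.
have [a Na wa] : exists2 a, (N <= a)%N & w < iter a f x.
  by have [[_ ?]|[? _]] := alt N (leqnn N); [exists N.+1|exists N].
have [Q fQ] := tame_frame (tame_iter 1 (tame_next a tx)).
have [_ [_ [_ [_ _ lo hi]]]] := fQ.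
have wQ : w < Q.1.
  have [n [_]] := lo 0%N; rewrite -iterM -iterD expn1 muln2 addnC.
  by have := (even a Na n).2 wa => ? ?; lra.
have [n [_ hn]] := hi 0%N.
exists Q, (n * 2 + a)%N, a; split => //; first by rewrite modnMDl.
move=> K Kx Km; exists (iter m f x), x; split => //; last first.
  by move: hn; rewrite -iterM -iterD.
rewrite -iterD (_ : (n * 2 + a + m = (a + (n + m./2).*2).+1)%N); last first.
  by have := odd_double_half m; rewrite om; lia.
have := (even a Na (n + m./2)%N).2 wa => ?.
by have [[? ?]|[_ ?]] := alt (a + (n + m./2).*2)%N ltac:(lia); lra.
Qed.

(** This is [odd_segment_covers] for the iterate of order [2 ^ logn 2 (r' - r)]. *)
Lemma segment_covers (R : realType) (f : R -> R) x r r' k : tame f x ->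
  (r < r')%N -> k = (logn 2 (r' - r)).+1 ->
  exists Q t c, [/\ frame (iter (2 ^ k) f) (iter c f x) Q,
    c = r + t %[mod 2 ^ k] &
    forall K, inI K (iter r f x) -> inI K (iter r' f x) -> covers f t K Q].
Proof.
move=> tx rr ->; set j := logn 2 (r' - r).
have [m om mE] : exists2 m, odd m & (r' - r = m * 2 ^ j)%N.
  have d0 : (0 < r' - r)%N by lia.
  have [m] := pfactor_coprime (isT : prime 2) d0.
  by rewrite coprime2n => om mE; exists m.
have [Q [t [c [fQ ct cov]]]] := odd_segment_covers (tame_iter j (tame_next r tx)) om.
exists Q, (t * 2 ^ j)%N, (c * 2 ^ j + r)%N; split.
- move: fQ; rewrite -iterM -iterD.
  by rewrite (_ : iter 2 _ = iter (2 ^ j.+1) f)//; apply/funext => y; rewrite expnS iterM.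
- by rewrite addnC; apply/eqP; rewrite eqn_modDl expnS -!muln_modl ct.
- move=> K Kr Kr'; apply: covers_iter; apply: cov => //.
  by rewrite -iterM -iterD -mE subnK// ltnW.
Qed.

(** A degenerate segment cannot cover a frame. *)
Lemma tame_injective (R : realType) (f : R -> R) x r r' : tame f x ->
  (r < r')%N -> iter r f x <> iter r' f x.
Proof.
move=> tx rr e; have [Q [t [c [fQ _ cov]]]] := segment_covers tx rr erefl.
have [|u [v [/andP[/= ? ?] /andP[/= ? ?] fu fv]]] :=
  cov (iter r f x, iter r f x) _ (ltac:(by rewrite -e /inI /= lexx)).
  by rewrite /inI /= lexx.
have uv : u = v by lra.
by have := frame_ordered fQ; rewrite uv in fu; lra.
Qed.

(** * Intervals that shadow an orbit *)

(** If [K] is regarded as located at time [c] modulo [2 ^ k], it contains, at all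
    compatible times, points that shadow the orbit of [x]. Keeping track of [c]
    reduces the synchronisation of several intervals to congruences. *)
Definition live (R : realType) (f : R -> R) (x : R) (K : R * R) (k c : nat) :=
  exists N, forall s n, (N <= s)%N -> (s + N <= n)%N ->
  n = c + s %[mod 2 ^ k] -> exists2 u, inI K u & iter s f u = iter n f x.

Lemma eqn_mod_pow2 k k' a b : (k <= k')%N ->
  a = b %[mod 2 ^ k'] -> a = b %[mod 2 ^ k].
Proof.
move=> kk ab; have d : (2 ^ k %| 2 ^ k')%N by rewrite dvdn_Pexp2l.
by rewrite -(modn_dvdm _ d) ab modn_dvdm.
Qed.

Lemma live_refine (R : realType) (f : R -> R) x K k c k' c' :
  (k <= k')%N -> c' = c %[mod 2 ^ k] -> live f x K k c -> live f x K k' c'.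
Proof.
move=> kk cc [N h]; exists N => s n Ns sn e; apply: h => //.
by rewrite (eqn_mod_pow2 kk e); apply/eqP; rewrite eqn_modDr; apply/eqP.
Qed.

Lemma live_covers (R : realType) (f : R -> R) x t K Q k c c' : continuous f ->
  covers f t K Q -> c' = c + t %[mod 2 ^ k] ->
  live f x Q k c' -> live f x K k c.
Proof.
move=> cf KQ cc [N h]; exists (N + t)%N => s n Ns sn e.
have [||| u Qu us] := h (s - t)%N n; try lia.
  rewrite e (_ : (c + s = c + t + (s - t))%N); last lia.
  by apply/eqP; rewrite eqn_modDr cc.
have [v Kv vu] := covers_ivt cf KQ Qu.
by exists v => //; rewrite -us -vu -iterD subnK//; lia.
Qed.

Lemma frame_loop (R : realType) (f : R -> R) x Q : frame f x Q -> covers f 2 Q Q.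
Proof.
move=> [w1 [w2 [n0 [[? ? ?] inw lo hi]]]].
have [n [n0n nlo]] := lo (n0 + 2)%N; have [m [n0m mhi]] := hi (n0 + 2)%N.
have nE : n = (n - 2).+2 by lia.
have mE : m = (m - 2).+2 by lia.
have := inw (n - 2)%N ltac:(lia); have := inw (m - 2)%N ltac:(lia).
rewrite -nE -mE => mI nI; exists (iter (n - 2) f x), (iter (m - 2) f x).
rewrite -!iterD !add2n -nE -mE.
by split => //; rewrite /inI; clear nE mE; case: mI nI => ? [] ?; lra.
Qed.

(** One of [n - s] and [n - s + 2 * 2 ^ k] is the time of a point in the inner
    part of the frame; in the second case the loop of the frame supplies the
    missing steps. *)
Lemma frame_live (R : realType) (f : R -> R) x Q k c : continuous f ->
  frame (iter (2 ^ k) f) (iter c f x) Q -> live f x Q k c.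
Proof.
move=> cf fQ; have loop := covers_iter (frame_loop fQ).
have [w1 [w2 [n0 [[Q1 w12 Q2] inw _ _]]]] := fQ.
exists (2 * 2 ^ k + c + n0 * 2 ^ k)%N => s n Ns sn nE.
have [i [ni n0i]] : exists i, n = (s + (i * 2 ^ k + c))%N /\ (n0 <= i)%N.
  have cs : (c + s <= n)%N by lia.
  have /dvdnP[i iE] : (2 ^ k %| n - (c + s))%N by rewrite -eqn_mod_dvd//; apply/eqP.
  exists i; split; first lia.
  have k0 : (0 < 2 ^ k)%N := expn_gt0 2 k.
  by rewrite -(leq_pmul2r k0); lia.
have := inw i n0i; rewrite -!iterM -!iterD => -[iQ|iQ].
  by exists (iter (i * 2 ^ k + c) f x); [rewrite /inI; lra|rewrite -iterD -ni].
have iQ' : inI Q (iter (i.+2 * 2 ^ k + c) f x) by rewrite /inI; lra.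
have [u Qu uE] := covers_ivt cf loop iQ'.
exists u => //; rewrite (_ : s = (s - 2 * 2 ^ k) + 2 * 2 ^ k)%N; last lia.
by rewrite iterD uE -iterD; congr iter; lia.
Qed.

(** Closeness over windows of arbitrary finite length; see [often_proximal]. *)
Definition proximal (R : realType) (f : R -> R) (x y : R) :=
  forall U (e : R), 0 < e -> often (fun n =>
    forall u, (u <= U)%N -> `|iter (n + u) f x - iter (n + u) f y| < e).

Lemma proximal_sym (R : realType) (f : R -> R) x y :
  proximal f x y -> proximal f y x.
Proof.
by move=> pr U e e0; apply: often_sub (pr U e e0) => n h u /h; rewrite distrC.
Qed.

(** Near a limit point of the times at which the orbits are close, finitely many
    iterates of [f] are equicontinuous. *)
Lemma often_proximal (R : realType) (f : R -> R) x y B : continuous f ->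
  (forall n, `|iter n f x| <= B) ->
  (forall e : R, 0 < e -> often (fun n => `|iter n f x - iter n f y| < e)) ->
  proximal f x y.
Proof.
move=> cf hB near U e e0.
have /choice[m hm] j : exists m, (j <= m)%N /\
    `|iter m f x - iter m f y| < j.+1%:R^-1 by apply: near; rewrite invr_gt0.
have mK : ((fun j => iter (m j) f x) @ \oo) `[- B, B]%classic.
  by exists 0%N => // j _ /=; rewrite in_itv/= -ler_norml.
have [p [_ clp]] := segment_compact _ mK.
have [d d0 hd] : exists2 d, 0 < d & forall u, (u <= U)%N -> forall z,
    `|z - p| < d -> `|iter u f z - iter u f p| < e / 2.
  elim: {near} U => [|U [d d0 hd]].
    by exists (e / 2); [rewrite divr_gt0|case].
  have [d' d'0 hd'] := continuous_dist (@iter_continuous _ _ U.+1 cf) p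
    (ltac:(by rewrite divr_gt0) : 0 < e / 2).
  exists (Num.min d d'); first by rewrite lt_min d0.
  move=> u; rewrite leq_eqVlt ltnS => /orP[/eqP ->|uU] z; rewrite lt_min => /andP[zd zd'].
    exact: hd'.
  exact: hd.
move=> N; pose J := (N + Num.truncn (d / 2)^-1)%N.
have [|_ [[j Jj <-] jp]] := clp [set iter (m j) f x | j in [set j | (J <= j)%N]]
  (ball p (d / 2)) _ (nbhsx_ballx p _ (ltac:(by rewrite divr_gt0) : 0 < d / 2)).
  by exists J => // j /= Jj; exists j.
have [jm xy] := hm j; exists (m j); split; first by move: Jj jm; rewrite /= /J; lia.
have {}jp : `|iter (m j) f x - p| < d / 2 by rewrite distrC.
have {}xy : `|iter (m j) f x - iter (m j) f y| < d / 2.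
  apply: lt_trans xy _; rewrite invf_plt ?posrE ?divr_gt0//.
  apply: lt_le_trans (truncnS_gt _) _; rewrite ler_nat ltnS.
  exact: leq_trans (leq_addl _ _) Jj.
move=> u uU; rewrite addnC !iterD (splitr e).
apply: le_lt_trans (ler_distD (iter u f p) _ _) (ltrD (hd u uU _ _) _).
  lra.
rewrite distrC; apply: hd => //.
by rewrite distrC in xy; apply: le_lt_trans (ler_distD (iter (m j) f x) _ _) _; lra.
Qed.

(** At a time when the two orbits are close, one waits for the next passage of
    [x] through the inner part of the frame, where there is room for [y]. *)
Lemma frame_visits (R : realType) (f : R -> R) x y Q k c : proximal f x y ->
  frame (iter (2 ^ k) f) (iter c f x) Q ->
  forall N, exists q, [/\ (N <= q)%N, q = c %[mod 2 ^ k] & inI Q (iter q f y)].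
Proof.
move=> pr [w1 [w2 [n0 [[Q1 w12 Q2] inw _ _]]]] N.
have [e [e0 e1 e2]] : exists e, [/\ 0 < e, e <= w1 - Q.1 & e <= Q.2 - w2].
  exists (Num.min (w1 - Q.1) (Q.2 - w2)).
  by rewrite lt_min !ge_min !lexx orbT !subr_gt0 Q1 Q2.
have [m [Nm hm]] := pr (3 * 2 ^ k)%N e e0 (N + c + n0 * 2 ^ k)%N.
have k0 : (0 < 2 ^ k)%N := expn_gt0 2 k.
have [i [u [uk ui n0i]]] : exists i u, [/\ (u <= 2 ^ k)%N,
    (m + u = i * 2 ^ k + c)%N & (n0 <= i)%N].
  exists ((m - c) %/ 2 ^ k).+1, (2 ^ k - (m - c) %% 2 ^ k)%N.
  have := divn_eq (m - c) (2 ^ k); have := ltn_pmod (m - c) k0.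
  move: (_ %/ _)%N (_ %% _)%N => a b bk mE.
  split; [lia|rewrite mulSn; lia|].
  have : (n0 * 2 ^ k < a.+1 * 2 ^ k)%N by rewrite mulSn; lia.
  by rewrite ltn_pmul2r// => /ltnW.
have near v : (v <= 3 * 2 ^ k)%N -> w1 <= iter (m + v) f x <= w2 ->
    inI Q (iter (m + v) f y).
  by move=> /hm; rewrite /inI ltr_norml => /andP[? ?] /andP[? ?]; lra.
have := inw i n0i; rewrite -!iterM -!iterD => -[iw|iw].
  exists (m + u)%N; split; [lia|by rewrite ui modnMDl|].
  by apply: near; [lia|rewrite ui].
have uE : ((m + (u + 2 * 2 ^ k)) = (i.+2 * 2 ^ k + c))%N by rewrite addnA ui; lia.
exists (m + (u + 2 * 2 ^ k))%N; split; [lia|by rewrite uE modnMDl|].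
by apply: near; [lia|rewrite uE].
Qed.

(** * A proximal pair without horseshoes *)

(** The members of the scrambling family. *)
Definition ready (R : realType) (f : R -> R) (x y : R) (Q : R * R) :=
  (exists2 c, (0 < c)%N & covers f c Q Q) /\
  exists k c, live f x Q k c /\ live f y Q k c.

Lemma segment_live (R : realType) (f : R -> R) x r r' k K : tame f x ->
  (r < r')%N -> k = (logn 2 (r' - r)).+1 ->
  inI K (iter r f x) -> inI K (iter r' f x) -> live f x K k r.
Proof.
move=> tx rr kE Kr Kr'; have [cf _ _ _] := tx.
have [Q [t [c [fQ cr cov]]]] := segment_covers tx rr kE.
exact: live_covers cf (cov K Kr Kr') cr (frame_live cf fQ).
Qed.

(** The frame covered by the segment contains two points of the orbit of [y],
    at times with the same residue modulo [2 ^ k], so that it is also live for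
    [y]. The level rises from [k] to [k'], but [c] remains congruent to [r]
    modulo [2 ^ k]; this is what keeps two such segments synchronised. *)
Lemma segment_ready (R : realType) (f : R -> R) x y r r' k K : tame f x ->
  tame f y -> proximal f x y -> (r < r')%N -> k = (logn 2 (r' - r)).+1 ->
  inI K (iter r f x) -> inI K (iter r' f x) ->
  (exists Q t, covers f t K Q /\ ready f x y Q) /\
  exists k' c, [/\ (k <= k')%N, c = r %[mod 2 ^ k], live f x K k' c & live f y K k' c].
Proof.
move=> tx ty pr rr kE Kr Kr'; have [cf _ _ _] := tx.
have [Q [t [c [fQ cr cov]]]] := segment_covers tx rr kE.
have KQ := cov K Kr Kr'.
have [q [_ qc Qq]] := frame_visits pr fQ 0.
have [q' [qq qc' Qq']] := frame_visits pr fQ q.+1.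
pose k' := (logn 2 (q' - q)).+1.
have kk : (k <= k')%N.
  apply: leqW; rewrite -pfactor_dvdn//; last lia.
  by rewrite -eqn_mod_dvd ?qc' ?qc//; lia.
have lx : live f x Q k' q := live_refine kk qc (frame_live cf fQ).
have ly : live f y Q k' q := segment_live ty qq erefl Qq Qq'.
have [c' cE] : exists c', q = c' + t %[mod 2 ^ k'].
  (* A natural number congruent to [q - t]. *)
  exists (q + t * (2 ^ k' - 1))%N.
  have k0 : (0 < 2 ^ k')%N := expn_gt0 2 k'.
  rewrite (_ : (_ + t)%N = (t * 2 ^ k' + q)%N) ?modnMDl//.
  by rewrite mulnBr muln1; have := leq_pmulr t k0; lia.
split.
  exists Q, t; split => //; split; last by exists k', q.
  exists (2 * 2 ^ k)%N; first by rewrite muln_gt0 expn_gt0.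
  exact: covers_iter (frame_loop fQ).
exists k', c'; split => //; try exact: live_covers cf KQ cE _.
apply/eqP; rewrite -(eqn_modDr t) -cr -qc; apply/eqP.
exact/esym/(eqn_mod_pow2 kk cE).
Qed.

(** Of three distinct values the middle one qualifies. *)
Lemma often_between (R : realType) (X : nat -> R) (P : nat -> Prop) :
  (forall r r', (r < r')%N -> X r <> X r') -> often P ->
  often (fun n => [/\ P n, exists2 l, P l & X l < X n &
                   exists2 h, P h & X n < X h]).
Proof.
move=> inj oP N; have [a [Na Pa]] := oP N.
have [b [ab Pb]] := oP a.+1; have [c [bc Pc]] := oP b.+1.
have key u v w : (N <= v)%N -> P u -> P v -> P w -> X u < X v -> X v < X w ->
    exists n, (N <= n)%N /\ [/\ P n, exists2 l, P l & X l < X n &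
      exists2 h, P h & X n < X h].
  by move=> ? ? ? ? ? ?; exists v; split => //; split => //; [exists u|exists w].
have Nb : (N <= b)%N by lia.
have Nc : (N <= c)%N by lia.
have := inj a b ab; have := inj b c bc; have := inj a c (ltac:(lia)).
have [ac _|ca _|//] := ltgtP (X a) (X c);
  have [bc' _|cb _|//] := ltgtP (X b) (X c);
  have [ab' _|ba _|//] := ltgtP (X a) (X b); first
  [ exact: (key a b c) | exact: (key b a c) | exact: (key a c b)
  | exact: (key c a b) | exact: (key b c a) | exact: (key c b a) | lra].
Qed.

Definition hull (R : realType) (a b : R) := (Num.min a b, Num.max a b).

Lemma hullP (R : realType) (a b : R) : inI (hull a b) a /\ inI (hull a b) b.
Proof. by rewrite /inI /= !ge_min !le_max !lexx !orbT. Qed.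

Lemma hull_dist (R : realType) (a b c e : R) : `|a - b| < e ->
  inI (hull a b) c -> `|c - a| < e.
Proof.
rewrite /inI /= !ltr_norml => /andP[? ?].
by case: (leP a b) => ? /andP[? ?]; apply/andP; split; lra.
Qed.

Lemma covers_hull (R : realType) (f : R -> R) s K (X : nat -> R)
    (P : nat -> Prop) r r' :
  (forall n, P n -> exists2 u, inI K u & iter s f u = X n) ->
  (exists2 l, P l & X l < X r) -> (exists2 h, P h & X r < X h) ->
  (exists2 l, P l & X l < X r') -> (exists2 h, P h & X r' < X h) ->
  covers f s K (hull (X r) (X r')).
Proof.
move=> cov [l Pl lr] [h Ph hr] [l' Pl' lr'] [h' Ph' hr'].
have [u [Ku fu]] : exists u, inI K u /\ iter s f u < Num.min (X r) (X r').
  have [_|_] := leP (X r) (X r').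
    by have [u Ku uE] := cov l Pl; exists u; rewrite uE.
  by have [u Ku uE] := cov l' Pl'; exists u; rewrite uE.
have [v [Kv fv]] : exists v, inI K v /\ Num.max (X r) (X r') < iter s f v.
  have [_|_] := leP (X r) (X r').
    by have [v Kv vE] := cov h' Ph'; exists v; rewrite vE.
  by have [v Kv vE] := cov h Ph; exists v; rewrite vE.
by exists u, v.
Qed.

(** The extreme values are discarded, first for [X] and then for [Y], so that
    the coverings are strict for both sequences. *)
Lemma select_segments (R : realType) (f : R -> R) (X Y : nat -> R) s K K'
    (P : nat -> Prop) :
  (forall r r', (r < r')%N -> X r <> X r') ->
  (forall r r', (r < r')%N -> Y r <> Y r') -> often P ->
  (forall n, P n -> exists2 u, inI K u & iter s f u = X n) ->
  (forall n, P n -> exists2 u, inI K' u & iter s f u = Y n) ->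
  exists r r', [/\ (r < r')%N, P r, P r',
    covers f s K (hull (X r) (X r')) & covers f s K' (hull (Y r) (Y r'))].
Proof.
move=> iX iY oP KX KY; have := often_between iY (often_between iX oP).
move=> oPP; have [r [_ [[Pr lr hr] [l [Pl _ _] lY] [h [Ph _ _] hY]]]] := oPP 0%N.
have [r' [rr' [[Pr' lr' hr'] [l' [Pl' _ _] lY'] [h' [Ph' _ _] hY']]]] := oPP r.+1.
exists r, r'; split => //; first exact: covers_hull KX _ _ _ _.
by apply: covers_hull KY _ _ _ _; [exists l|exists h|exists l'|exists h'].
Qed.

Lemma exists_shift m c rho N : (0 < m)%N ->
  exists2 s, (N <= s)%N & rho = c + s %[mod m].
Proof.
move=> m0; (* Congruent to [rho - c]. *)
exists (rho + c * (m - 1) + N * m)%N.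
  exact: leq_trans (leq_pmulr N m0) (leq_addl _ _).
rewrite (_ : (c + _)%N = ((c + N) * m + rho)%N) ?modnMDl//.
by rewrite mulnBr muln1 mulnDl; have := leq_pmulr c m0; lia.
Qed.

(** A common duration [s] exists as soon as both intervals are live with the same
    level and residue. *)
Lemma live_select (R : realType) (f : R -> R) x y K K' k c
    (P : nat -> Prop) : tame f x -> tame f y ->
  live f x K k c -> live f y K' k c -> often P ->
  exists s r r', [/\ (r < r')%N, P r, P r',
    covers f s K (hull (iter r f x) (iter r' f x)) &
    covers f s K' (hull (iter r f y) (iter r' f y))].
Proof.
move=> tx ty [N1 h1] [N2 h2] oP.
have [rho orho] := often_residue (expn_gt0 2 k : 0 < 2 ^ k)%N oP.
have [s Ns sE] := exists_shift c rho (maxn N1 N2) (expn_gt0 2 k : 0 < 2 ^ k)%N.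
have o := often_late (s + maxn N1 N2) orho.
have [r [r' [rr [[Pr _] _] [[Pr' _] _] cX cY]]] := @select_segments _ f
  (fun n => iter n f x) (fun n => iter n f y) s K K' _
  (fun r r' => @tame_injective _ _ _ r r' tx)
  (fun r r' => @tame_injective _ _ _ r r' ty) o
  (fun n h => h1 s n (ltac:(lia)) (ltac:(lia)) (ltac:(rewrite -sE; exact: h.1.2)))
  (fun n h => h2 s n (ltac:(lia)) (ltac:(lia)) (ltac:(rewrite -sE; exact: h.1.2))).
by exists s, r, r'.
Qed.

Lemma pair_scrambling (R : realType) (f : R -> R) (x y e : R) :
  tame f x -> tame f y -> proximal f x y -> 0 < e ->
  often (fun n => e <= `|iter n f x - iter n f y|) ->
  scrambling f (e / 2) (ready f x y) /\ exists K, ready f x y K.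
Proof.
move=> tx ty pr e0 sep.
have [cf [B hB] _ _] := tx; have [_ [B' hB'] _ _] := ty.
split; last first.
  have [h0 h1] := hullP (iter 0 f x) (iter 1 f x).
  by have [[Q [t [_ rQ]]] _] := segment_ready tx ty pr (ltn0Sn 0) erefl h0 h1; exists Q.
move=> Q [loop [k [c [lx ly]]]]; split => // eta eta0.
have e4 : 0 < e / 4 by rewrite divr_gt0.
have [P1 [oP1 P1s c1]] := often_close hB e4 sep.
have [P2 [oP2 P21 c2]] := often_close hB' e4 oP1.
have [s [r [r' [rr Pr Pr' QA QB]]]] := live_select tx ty lx ly oP2.
set A := hull _ _ in QA; set B0 := hull _ _ in QB.
have [Ar Ar'] := hullP (iter r f x) (iter r' f x).
have [Br Br'] := hullP (iter r f y) (iter r' f y).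
have lA : live f x A _ r := segment_live tx rr erefl Ar Ar'.
have [_ [k' [c' [kk cc _ lB]]]] :=
  segment_ready ty tx (proximal_sym pr) rr erefl Br Br'.
have [P3 [oP3 _ c3]] : exists P3, [/\ often P3, forall n, P3 n -> True &
    forall n m, P3 n -> P3 m -> `|iter n f x - iter m f x| < eta].
  by apply: (often_close hB eta0) => N; exists N.
have [s' [q [q' [qq Pq Pq' AL BL]]]] :=
  live_select tx tx (live_refine kk cc lA) lB oP3.
set L := hull _ _ in AL BL.
have [Lq Lq'] := hullP (iter q f x) (iter q' f x).
have [[Q' [t [LQ rQ']]] _] := segment_ready tx ty pr qq erefl Lq Lq'.
exists s, s', t, A, B0, L, Q'; split => //.
  have := c3 _ _ Pq Pq'; rewrite /L /= ltr_norml => /andP[? ?].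
  by case: (leP (iter q f x) (iter q' f x)) => ?; lra.
move=> a b Aa Bb.
have := hull_dist (c1 _ _ (P21 _ Pr) (P21 _ Pr')) Aa.
have := hull_dist (c2 _ _ Pr Pr') Bb.
have := P1s _ (P21 _ Pr) => {}sep h1 h2.
have := ler_distD a (iter r f x) (iter r f y); have := ler_distD b a (iter r f y).
by rewrite (distrC (iter r f x) a); lra.
Qed.

(** * Upper and lower limits *)

Lemma limn_esup_often (R : realType) (u : nat -> R) (a e : R) :
  (a%:E <= limn_esup (fun n => (u n)%:E))%E -> e < a -> often (fun n => e < u n).
Proof.
move=> h ea N; apply: contrapT => /forallNP none.
have : (limn_esup (fun n => (u n)%:E) <= e%:E)%E.
  apply: ge_ereal_inf.
  exists (ereal_sup ((fun n => (u n)%:E) @` [set n | (N <= n)%N])).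
    by exists [set n | (N <= n)%N] => //; exists N.
  apply/ereal_supP => _ [n /= Nn <-]; rewrite lee_fin leNgt; apply/negP => en.
  by apply: (none n).
by move=> /(le_trans h); rewrite lee_fin leNgt ea.
Qed.

Lemma often_limn_esup (R : realType) (u : nat -> R) (a : R) :
  (forall e, e < a -> often (fun n => e < u n)) ->
  (a%:E <= limn_esup (fun n => (u n)%:E))%E.
Proof.
move=> h; apply/ereal_infP => _ [V [N _ NV] <-].
apply/lee_subgt0Pr => e e0; have [n [Nn en]] := h (a - e) (ltac:(lra)) N.
apply: le_ereal_sup_tmp; exists (u n)%:E; first by exists n => //; exact: NV.
by rewrite -EFinB lee_fin ltW.
Qed.

Lemma limn_einf0_often (R : realType) (u : nat -> R) (e : R) :
  limn_einf (fun n => (u n)%:E) = 0%E -> 0 < e -> often (fun n => u n < e).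
Proof.
move=> h e0.
have {h} : (0%:E <= limn_esup (fun n => (- u n)%:E))%E.
  by move: h => /(congr1 -%E); rewrite /limn_einf oppeK oppe0 => h; rewrite [leRHS]h.
move=> /limn_esup_often -/(_ (- e)); rewrite oppr_lt0 => /(_ e0).
by apply: often_sub => n; rewrite ltrN2.
Qed.

Lemma often_limn_einf0 (R : realType) (u : nat -> R) : (forall n, 0 <= u n) ->
  (forall e : R, 0 < e -> often (fun n => u n < e)) ->
  limn_einf (fun n => (u n)%:E) = 0%E.
Proof.
move=> u0 h; rewrite /limn_einf; suff -> : limn_esup (\- (fun n => (u n)%:E))%E = 0%E.
  by rewrite oppe0.
apply/eqP; rewrite eq_le; apply/andP; split.
  apply: ge_ereal_inf; exists (ereal_sup ((fun n => (- u n)%:E) @` setT)).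
    by exists setT => //; exists 0%N.
  by apply/ereal_supP => _ [n _ <-]; rewrite lee_fin oppr_le0.
apply: (@often_limn_esup _ (fun n => - u n) 0) => e e0.
by apply: often_sub (h (- e) _) => [n|]; [rewrite ltrNr|rewrite oppr_gt0].
Qed.

(** * Extending maps of the interval to the line *)

(** Composition with the retraction onto the interval extends its self-maps to
    continuous maps of the line. *)
Definition clamp (R : realType) (t : R) : R := Num.max 0 (Num.min 1 t).

Lemma clamp_I (R : realType) (t : R) : I01 (clamp t).
Proof.
by rewrite /I01 /= in_itv /= /clamp le_max lexx /= ge_max ler01 ge_min lexx.
Qed.

Lemma clamp_id (R : realType) (t : R) : I01 t -> clamp t = t.
Proof.
by rewrite /I01 /= in_itv /= /clamp => /andP[? ?]; rewrite min_r// max_r.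
Qed.

Lemma clamp_continuous (R : realType) : continuous (@clamp R).
Proof.
by move=> t; apply: continuous_max; [exact: cst_continuous|apply: continuous_min;
  [exact: cst_continuous|exact: cvg_id]].
Qed.

Lemma extension_continuous (R : realType) (f : R -> R) :
  {within I01, continuous f} -> continuous (fun t => f (clamp t)).
Proof.
move=> /subspace_continuousP cf; apply: dist_continuous => t e e0.
have /cvgrPdist_lt/(_ _ e0)[d /= d0 hd] := cf _ (clamp_I t).
have [d' d'0 hd'] := continuous_dist (@clamp_continuous R) t d0.
exists d' => // s st; rewrite distrC; apply: hd; last exact: clamp_I.
by rewrite /= distrC; exact: hd'.
Qed.

Lemma uniform_cvg_continuous (R : realType) (g : nat -> R -> R) (f : R -> R) :
  (forall n, continuous (g n)) -> uniform_cvg g f -> continuous f.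
Proof.
move=> cg gf; apply: dist_continuous => x e e0.
have e3 : 0 < e / 3 by rewrite divr_gt0.
have [N hN] := gf _ e3; have [d d0 hd] := continuous_dist (cg N) x e3.
exists d => // y /hd; have := hN N (leqnn N) x; have := hN N (leqnn N) y.
rewrite !ltr_norml => /andP[? ?] /andP[? ?] /andP[? ?].
by apply/andP; split; lra.
Qed.

Lemma uniform_I01 (R : realType) (fs : nat -> R -> R) (f : R -> R) :
  {uniform I01, fs @ \oo --> f} -> forall e : R, 0 < e ->
  exists N, forall n, (N <= n)%N -> forall x, I01 x -> `|fs n x - f x| < e.
Proof.
move=> fsf e e0.
have [] := fsf [set h | forall y, I01 y -> ball (f y) e (h y)].
  apply/uniform_nbhs; exists [set xy | ball xy.1 e xy.2]; split => //.
  by rewrite -entourage_ballE; exists e.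
by move=> N _ hN; exists N => n Nn x Ix; rewrite distrC; exact: hN.
Qed.

Lemma trajectory_extension (R : realType) (fs g : nat -> R -> R) x n :
  (forall i, (1 <= i)%N -> set_fun I01 I01 (fs i)) ->
  (forall i y, (1 <= i)%N -> I01 y -> g i y = fs i y) ->
  I01 x -> I01 (trajectory fs x n) /\ trajectory g x n = trajectory fs x n.
Proof.
move=> fsI gfs Ix; elim: n => [|n [IH1 IH2]] //=.
by split; [exact: fsI|rewrite IH2 gfs].
Qed.

Lemma trajectory_surj (R : realType) (fs : nat -> R -> R) n z :
  (forall i, (1 <= i)%N -> set_surj I01 I01 (fs i)) -> I01 z ->
  exists2 x, I01 x & trajectory fs x n = z.
Proof.
move=> surj; elim: n z => [|n IH] z Iz; first by exists z.
by have [y Iy <-] := surj n.+1 isT z Iz; have [x Ix <-] := IH y Iy; exists x.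
Qed.

Lemma trajectory_const (R : realType) (f : R -> R) x n :
  trajectory (fun=> f) x n = iter n f x.
Proof. by elim: n => [|n /= ->]. Qed.

(** * Li-Yorke pairs and asymptotic periodicity *)

Lemma nonconvergentPn (R : realType) (X : nat -> R) : ~ nonconvergent X ->
  exists l, forall e : R, 0 < e -> exists N, forall n, (N <= n)%N -> `|X n - l| < e.
Proof.
move=> /existsNP[l hl]; exists l => e e0.
have [|N hN] := not_often (P := fun n => e <= `|X n - l|).
  by move=> oe; apply: hl; exists e.
by exists N => n /hN /negP; rewrite -ltNge.
Qed.

Lemma nonconvergent_coarser (R : realType) (f : R -> R) x k K : (k <= K)%N ->
  nonconvergent (fun n => iter (n * 2 ^ K) f x) ->
  nonconvergent (fun n => iter (n * 2 ^ k) f x).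
Proof.
move=> kK nc l; have [e e0 oe] := nc l; exists e => // N.
have [n [Nn h]] := oe N; exists (n * 2 ^ (K - k))%N; split.
  by apply: leq_trans Nn _; rewrite leq_pmulr ?expn_gt0.
by rewrite -mulnA -expnD subnK.
Qed.

(** If both orbits converge along the multiples of [2 ^ K], then the limits
    coincide by proximality, and by continuity the orbits are asymptotic along
    all residues. *)
Lemma li_yorke_nonconvergent (R : realType) (f : R -> R) x y e k k' :
  continuous f -> proximal f x y -> 0 < e ->
  often (fun n => e <= `|iter n f x - iter n f y|) ->
  nonconvergent (fun n => iter (n * 2 ^ k) f x) \/
  nonconvergent (fun n => iter (n * 2 ^ k') f y).
Proof.
move=> cf pr e0 sep; pose K := maxn k k'.
apply: contrapT => /not_orP[nx ny].
have /nonconvergentPn[l hl] : ~ nonconvergent (fun n => iter (n * 2 ^ K) f x).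
  by move=> /(nonconvergent_coarser (leq_maxl k k')).
have /nonconvergentPn[l' hl'] : ~ nonconvergent (fun n => iter (n * 2 ^ K) f y).
  by move=> /(nonconvergent_coarser (leq_maxr k k')).
have K0 : (0 < 2 ^ K)%N := expn_gt0 2 K.
have ll : l = l'.
  apply/eqP; rewrite -subr_eq0 -normr_le0 leNgt; apply/negP => d0.
  have d3 : 0 < `|l - l'| / 3 by rewrite divr_gt0.
  have [N hN] := hl _ d3; have [N' hN'] := hl' _ d3.
  have [m [Nm hm]] := pr (2 ^ K)%N _ d3 ((N + N') * 2 ^ K)%N.
  have [i [u [uK ui Ni]]] : exists i u, [/\ (u <= 2 ^ K)%N,
      (m + u = i * 2 ^ K)%N & (N + N' <= i)%N].
    exists (m %/ 2 ^ K).+1, (2 ^ K - m %% 2 ^ K)%N.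
    have := divn_eq m (2 ^ K); have := ltn_pmod m K0.
    have : (N + N' <= m %/ 2 ^ K)%N by rewrite leq_divRL.
    move: (_ %/ _)%N (_ %% _)%N => a b Na bk mE.
    by split; [lia|rewrite mulSn; lia|lia].
  have := hm u uK; rewrite ui.
  have := hN i ltac:(lia); have := hN' i ltac:(lia).
  move: (iter _ f x) (iter _ f y) => a b h1 h2 h3.
  have := ler_distD a l l'; have := ler_distD b a l'.
  by rewrite (distrC l a); lra.
have [r orr] := often_residue K0 sep.
have [d d0 hd] := continuous_dist (iter_continuous (m := r %% 2 ^ K) cf) l
  (ltac:(by rewrite divr_gt0) : 0 < e / 2).
have [N hN] := hl _ d0; have [N' hN'] := hl' _ d0; rewrite -ll in hN'.
have [n [Nn [en nr]]] := orr ((N + N') * 2 ^ K)%N.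
pose i := (n %/ 2 ^ K)%N.
have nE : n = (r %% 2 ^ K + i * 2 ^ K)%N by rewrite {1}(divn_eq n (2 ^ K)) nr addnC.
have Ni : (N + N' <= i)%N by rewrite leq_divRL.
have h1 := hd _ (hN i ltac:(lia)); have h2 := hd _ (hN' i ltac:(lia)).
move: en; rewrite nE !iterD => en.
have := ler_distD (iter (r %% 2 ^ K) f l) (iter (r %% 2 ^ K) f (iter (i * 2 ^ K) f x))
  (iter (r %% 2 ^ K) f (iter (i * 2 ^ K) f y)).
by rewrite (distrC (iter _ f l)); lra.
Qed.

Lemma uncountable_three (T : Type) (S : set T) : ~ countable S ->
  exists a b c, [/\ S a, S b, S c & [/\ a <> b, a <> c & b <> c]].
Proof.
move=> nS.
have out (F : set T) : finite_set F -> exists2 z, S z & ~ F z.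
  move=> finF; apply: contrapT => h; apply: nS; apply: finite_set_countable.
  apply: sub_finite_set finF => z Sz; apply: contrapT => nF; apply: h.
  by exists z.
have [a Sa _] := out set0 (finite_set0 T).
have [b Sb ba] := out [set a] (finite_set1 a).
have [c Sc cab] := out ([set a] `|` [set b]) ltac:(by rewrite finite_setU).
exists a, b, c; split => //; split.
- by move=> ab; apply: ba.
- by move=> ac; apply: cab; left.
- by move=> bc; apply: cab; right.
Qed.

(** * The scrambled set of the nonautonomous system *)

(** Cantor's diagonal argument. *)
Lemma uncountable_range (T : Type) (p : (nat -> bool) -> T) :
  injective p -> ~ countable (range p).
Proof.
move=> injp /countable_injP[h injh].
have injhp t t' : h (p t) = h (p t') -> t = t'.
  by move=> /injh e; apply: injp; apply: e; apply/mem_set; eexists.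
pose D n := ~~ `[< exists t, h (p t) = n /\ t n >].
have : D (h (p D)) = ~~ D (h (p D)).
  rewrite {1}/D; congr (~~ _); apply/asboolP/idP => [[t [/injhp -> //]]|DD].
  by exists D.
by case: (D _).
Qed.

(** Every bit of [t] is repeated infinitely often: the indices [i] with
    [logn 2 i.+1 = v] are the numbers [2 ^ v * (2 * j + 1) - 1]. *)
Definition spread (t : nat -> bool) (i : nat) := t (logn 2 i.+1).

Lemma spread_often (t t' : nat -> bool) : t <> t' ->
  often (fun i => spread t i <> spread t' i).
Proof.
move=> tt N; have [v tv] : exists v, t v <> t' v.
  by apply: contrapT => /forallNP h; apply: tt; apply/funext => v; apply: contrapT (h v).
(* An odd cofactor keeps the valuation equal to [v]. *)
exists (2 ^ v * (N.*2.+1)).-1.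
have k0 : (0 < 2 ^ v)%N := expn_gt0 2 v.
split; first by have := leq_pmull N.*2.+1 k0; lia.
rewrite /spread prednK ?muln_gt0 ?k0// lognM// pfactorK// lognE.
by rewrite dvdn2 /= odd_double /= addn0.
Qed.

(** The scrambled family starts at time [T]. One more step brings its points
    into the interval, where they have preimages at time 0. *)
Lemma LYC_of_scrambling (R : realType) (fs g : nat -> R -> R) (F : R -> R)
    (delta : R) (Q : R * R -> Prop) (K : R * R) :
  (forall n, (1 <= n)%N -> set_fun I01 I01 (fs n)) ->
  (forall n, (1 <= n)%N -> set_surj I01 I01 (fs n)) ->
  (forall n x, (1 <= n)%N -> I01 (g n x)) ->
  (forall n x, (1 <= n)%N -> I01 x -> g n x = fs n x) ->
  (forall n, continuous (g n)) -> uniform_cvg g F ->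
  0 < delta -> scrambling F delta Q -> Q K -> LYC fs.
Proof.
move=> fsI surj gI gfs cg gF delta0 scr QK.
have cF := uniform_cvg_continuous cg gF.
have [T [z hz]] := scrambled_family cF cg gF scr QK.
have /choice[p hp] t : exists x, I01 x /\
    trajectory fs x T.+1 = run g T 1 (z (spread t)).
  by have [x Ix xE] := trajectory_surj T.+1 surj (gI (T + 1)%N (z (spread t)) ltac:(lia)); exists x.
have shadow t n : trajectory fs (p t) (T.+1 + n) = run g T n.+1 (z (spread t)).
  have [Ip pE] := hp t.
  have ext m := trajectory_extension m fsI gfs Ip.
  have gx m : trajectory g (p t) (T.+1 + m) = run g T.+1 m (trajectory g (p t) T.+1).
    exact: (run_add g 0 T.+1 m (p t)).
  rewrite -(ext _).2 gx (ext _).2 pE -[n.+1]add1n run_add.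
  by rewrite addn1.
have transfer t t' (P : R -> Prop) :
  often (fun n => P `|run g T n (z (spread t)) - run g T n (z (spread t'))|) ->
  often (fun n => P `|trajectory fs (p t) n - trajectory fs (p t') n|).
  move=> oP N; have [n [Nn Pn]] := oP N.+1.
  exists (T.+1 + n.-1)%N; split; first lia.
  by rewrite !shadow prednK//; lia.
have far t t' : t <> t' ->
    often (fun n => delta <= `|trajectory fs (p t) n - trajectory fs (p t') n|).
  move=> /spread_often tt; apply: (transfer t t' (fun r => delta <= r)).
  exact: (hz _ _).2.
have injp : injective p.
  move=> t t' e; apply: contrapT => /far; rewrite e => /(_ 0%N)[n [_]].
  by rewrite subrr normr0 leNgt delta0.
exists delta; split => //; exists (range p); split.
- by move=> _ [t _ <-]; exact: (hp t).1.
- exact: uncountable_range.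
- move=> _ _ [t _ <-] [t' _ <-] pp; split.
    apply: often_limn_esup => e ed.
    apply: often_sub (far t t' _) => [n|tt]; first exact: lt_le_trans.
    by apply: pp; rewrite tt.
  apply: often_limn_einf0 => [n|e e0]; first exact: normr_ge0.
  by apply: (transfer t t' (fun r => r < e)); exact: (hz _ _).1.
Qed.

Lemma LYC_scrambling (R : realType) (f F : R -> R) : continuous F ->
  (forall x, I01 (F x)) -> (forall x, I01 x -> F x = f x) ->
  LYC (fun=> f) ->
  exists delta Q K, [/\ 0 < delta, scrambling F delta Q & Q K].
Proof.
move=> cF FI Ff [eps [eps0 [S [SI uS SLY]]]].
have [[k Hk]|nH] := pselect (exists k, horseshoe (iter (2 ^ k) F)).
  by apply: horseshoe_scrambling Hk => //; rewrite expn_gt0.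
have orb x n : S x -> trajectory (fun=> f) x n = iter n F x.
  move=> /SI Ix; rewrite -trajectory_const; apply/esym.
  apply: (trajectory_extension (fs := fun=> f) (g := fun=> F) n _ _ Ix).2.
    by move=> _ _ y Iy; rewrite -Ff.
  by move=> _ y _; exact: Ff.
have bnd x : S x -> forall n, `|iter n F x| <= 1.
  move=> /SI Ix [|n] /=; first by move: Ix; rewrite /I01 /= in_itv /= ler_norml; lra.
  by have := FI (iter n F x); rewrite /I01 /= in_itv /= ler_norml; lra.
have sep x y : S x -> S y -> x <> y ->
    often (fun n => eps / 2 <= `|iter n F x - iter n F y|).
  move=> Sx Sy xy; have [/limn_esup_often + _] := SLY x y Sx Sy xy.
  move=> /(_ (eps / 2)) => /(_ (ltac:(lra))).
  by apply: often_sub => n; rewrite !orb// => /ltW.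
have prox x y : S x -> S y -> x <> y -> proximal F x y.
  move=> Sx Sy xy; apply: (often_proximal cF (bnd x Sx)) => e e0.
  have [_ inf0] := SLY x y Sx Sy xy.
  by apply: often_sub (limn_einf0_often inf0 e0) => n; rewrite !orb.
have tameP x : S x -> ~ tame F x -> exists k, ~ nonconvergent (fun n => iter (n * 2 ^ k) F x).
  move=> Sx nt; apply/existsNP => nc; apply: nt; split => //.
    by exists 1; exact: bnd.
  by move=> k Hk; apply: nH; exists k.
have eps2 : 0 < eps / 2 by rewrite divr_gt0.
have one x y : S x -> S y -> x <> y -> ~ tame F x -> tame F y.
  move=> Sx Sy xy /(tameP x Sx)[k hk]; apply: contrapT => /(tameP y Sy)[k' hk'].
  by have [] := li_yorke_nonconvergent k k' cF (prox _ _ Sx Sy xy) eps2 (sep _ _ Sx Sy xy).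
have [a [b [c [Sa Sb Sc [ab ac bc]]]]] := uncountable_three uS.
have [x [y [Sx Sy xy tx ty]]] : exists x y, [/\ S x, S y, x <> y, tame F x & tame F y].
  have [ta|na] := pselect (tame F a).
    have [tb|nb] := pselect (tame F b); first by exists a, b.
    by exists a, c; split => //; exact: one nb.
  by exists b, c; split => //; [exact: one na|exact: one na].
have [scr [K rK]] := pair_scrambling tx ty (prox _ _ Sx Sy xy) eps2 (sep _ _ Sx Sy xy).
by exists (eps / 2 / 2), (ready F x y), K; split => //; rewrite divr_gt0.
Qed.

Theorem theoremC (R : realType) (fs : nat -> R -> R) (f : R -> R)
    (fs_map : forall n, (1 <= n)%N -> set_fun I01 I01 (fs n))
    (fs_surj : forall n, (1 <= n)%N -> set_surj I01 I01 (fs n))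
    (fs_cont : forall n, (1 <= n)%N -> {within I01, continuous (fs n)})
    (f_map : set_fun I01 I01 f)
    (f_surj : set_surj I01 I01 f)
    (fs_cvg : {uniform I01, fs @ \oo --> f})
    (f_LYC : LYC (fun _ : nat => f)) :
  LYC fs.
Proof.
(* [maxn 1 n] because nothing is assumed about [fs 0]. *)
pose g n x := fs (maxn 1 n) (clamp x).
pose F x := f (clamp x).
have m1 n : (1 <= maxn 1 n)%N by lia.
have cg n : continuous (g n) by apply: extension_continuous; exact: fs_cont.
have gF : uniform_cvg g F.
  move=> e e0; have [N hN] := uniform_I01 fs_cvg e0.
  by exists N => n Nn x; apply: hN; [lia|exact: clamp_I].
have FI x : I01 (F x) by apply: f_map; exact: clamp_I.
have Ff x : I01 x -> F x = f x by move=> Ix; rewrite /F clamp_id.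
have [delta [Q [K [delta0 scr QK]]]] :=
  LYC_scrambling (uniform_cvg_continuous cg gF) FI Ff f_LYC.
apply: (@LYC_of_scrambling R fs g F delta Q K) => //.
- by move=> n x _; apply: fs_map => //; exact: clamp_I.
- by move=> n x n1 Ix; rewrite /g clamp_id// (maxn_idPr n1).
Qed.
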